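(* Let $H=\sum_{Z} h^Z$ be a local bounded Hamiltonian on a finite $D$-dimensional lattice $\Lambda$, let $\beta>0$, and suppose $(H,\beta)$ is uniformly $\epsilon(\ell)$-clustering. Let $X\subseteq\Lambda$ be partitioned into disjoint sets $X=A\cup B\cup C$ such that $B$ shields $A$ from $C$ in $X$ by a distance at least $\ell$, i.e. $\mathrm{dist}(A,C)\ge \ell$ and every path in $X$ from $A$ to $C$ passes through $B$. Let $\rho^X$ be the Gibbs state of $H^X$ and $\rho^{AB}$ the Gibbs state of $H^{AB}$. Then $$\big\|\mathrm{tr}_{BC}(\rho^X)-\mathrm{tr}_{B}(\rho^{AB})\big\|_1\le K\,|\partial C|\,\big(\epsilon(\ell/2)+\gamma(\ell/2)\big),$$ where $K$ is a constant independent of $\ell$ and of the regions, $\partial C$ is the set of sites of $C$ neighbouring $B$, and $\gamma$ is the belief-propagation error function of the model.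
   Context: Spins with finite-dimensional local Hilbert spaces sit on the sites of a finite square lattice $\Lambda\subseteq\mathbb{Z}^D$; $\mathrm{dist}$ is Euclidean distance, extended to sets by minimum. A local bounded Hamiltonian is $H=\sum_{Z\subset\Lambda}h^Z$ with each $h^Z$ bounded (uniformly) and supported on a constant number of adjacent sites. For $Y\subseteq\Lambda$, $H^Y=\sum_{Z\subseteq Y}h^Z$ (terms fully supported in $Y$) and $\rho^Y=e^{-\beta H^Y}/\mathrm{tr}\,e^{-\beta H^Y}$ is the Gibbs state on $Y$ (not the reduction of the global Gibbs state). Subscripts denote partial traces. The covariance is $\mathrm{Cov}_\sigma(f,g)=|\mathrm{tr}(\sigma fg)-\mathrm{tr}(\sigma f)\mathrm{tr}(\sigma g)|$. $(H,\beta)$ is uniformly $\epsilon(\ell)$-clustering if for every $X\subseteq\Lambda$ and all $A,B\subseteq X$ with $\mathrm{dist}(A,B)\ge\ell$, and all observables $f$ supported on $A$ and $g$ on $B$, $\mathrm{Cov}_{\rho^X}(f,g)\le\|f\|\,\|g\|\,\epsilon(\ell)$. Belief propagation error (standing assumption, from quantum belief propagation): there are constants $c_1,c_2$ and $\gamma(\ell)=c_1e^{-c_2\ell}$ such that whenever two Gibbs states $\rho^{Y}$, $\rho^{Y'}$ with $Y'=Y\setminus\{y\}$ differ by the constant number of Hamiltonian terms touching a single site $y$, there is an operator $\eta_\ell$ supported on the ball of radius $\ell$ around $y$, with $\|\eta_\ell^\dagger\eta_\ell\|$ bounded by a constant independent of $\ell$, such that $\|\rho^{Y'}-\eta_\ell\rho^{Y}\eta_\ell^\dagger\|_1\le\gamma(\ell)$.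 *)

(* Defs.v *)
From Stdlib Require Import Reals List ZArith Classical ClassicalEpsilon.
Import ListNotations.
Open Scope R_scope.

Definition Cx := (R * R)%type.
Definition C0 : Cx := (0, 0).
Definition C1 : Cx := (1, 0).
Definition Cadd (x y : Cx) : Cx := (fst x + fst y, snd x + snd y).
Definition Copp (x : Cx) : Cx := (- fst x, - snd x).
Definition Cmul (x y : Cx) : Cx :=
  (fst x * fst y - snd x * snd y, fst x * snd y + snd x * fst y).
Definition Cconj (x : Cx) : Cx := (fst x, - snd x).
Definition Cscale (r : R) (x : Cx) : Cx := (r * fst x, r * snd x).
Definition Cmod (x : Cx) : R := sqrt (fst x ^ 2 + snd x ^ 2).

Definition Site := list Z.   (* a point of Z^D, as a list of length D *)
Definition site_eq_dec : forall x y : Site, {x = y} + {x <> y} :=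
  list_eq_dec Z.eq_dec.
Definition sdist (x y : Site) : R :=
  sqrt (fold_right Rplus 0
          (map (fun p => (IZR (fst p - snd p)) ^ 2) (combine x y))).
Definition mem (x : Site) (Y : list Site) : bool :=
  if in_dec site_eq_dec x Y then true else false.
Definition subl (Z Y : list Site) : bool := forallb (fun x => mem x Y) Z.
Definition minus (Y Z : list Site) : list Site :=
  filter (fun x => negb (mem x Z)) Y.
Definition remove1 (Y : list Site) (y : Site) : list Site := minus Y [y].
Definition ball (Y : list Site) (y : Site) (l : R) : list Site :=
  filter (fun s => if Rle_dec (sdist s y) l then true else false) Y.

Definition adjacent (x y : Site) : Prop := sdist x y = 1.
Fixpoint is_path (p : list Site) : Prop :=
  match p with
  | [] => True
  | x :: p' => match p' with [] => True | y :: _ => adjacent x y /\ is_path p' end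
  end.
Definition connected (Z : list Site) : Prop :=
  forall x y, In x Z -> In y Z ->
    exists q, is_path (x :: q) /\ last q x = y /\ incl (x :: q) Z.
Definition separates (X A B C : list Site) : Prop :=
  forall x q, In x A -> In (last q x) C -> incl (x :: q) X -> is_path (x :: q) ->
    exists b, In b B /\ In b (x :: q).
Definition boundary (C B : list Site) : list Site :=
  filter (fun c => existsb (fun b => if Req_EM_T (sdist c b) 1 then true else false) B) C.

(* d : local Hilbert space dimension of each site.  A basis state of region Y
   is a configuration Conf (value < d s at s in Y, 0 outside Y). *)
Definition Conf := Site -> nat.
Definition upd (c : Conf) (y : Site) (i : nat) : Conf :=
  fun s => if site_eq_dec s y then i else c s.
Fixpoint confs (d : Site -> nat) (Y : list Site) : list Conf :=
  match Y with
  | [] => [fun _ => 0%nat]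
  | y :: Y' => flat_map (fun c => map (fun i => upd c y i) (seq 0 (d y))) (confs d Y')
  end.

Definition Op := Conf -> Conf -> Cx.   (* matrix in the configuration basis *)
Definition Vec := Conf -> Cx.
Definition zero_op : Op := fun _ _ => C0.

Definition csum {T} (l : list T) (f : T -> Cx) : Cx :=
  fold_right (fun x acc => Cadd (f x) acc) C0 l.
Definition conf_eqb (Y : list Site) (s t : Conf) : bool :=
  forallb (fun x => Nat.eqb (s x) (t x)) Y.

Definition idop (Y : list Site) : Op := fun s t => if conf_eqb Y s t then C1 else C0.
Definition opmul d Y (M N : Op) : Op :=
  fun s t => csum (confs d Y) (fun u => Cmul (M s u) (N u t)).
Definition opadd (M N : Op) : Op := fun s t => Cadd (M s t) (N s t).
Definition opsub (M N : Op) : Op := fun s t => Cadd (M s t) (Copp (N s t)).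
Definition opscale (r : R) (M : Op) : Op := fun s t => Cscale r (M s t).
Definition adj (M : Op) : Op := fun s t => Cconj (M t s).
Definition trace d Y (M : Op) : Cx := csum (confs d Y) (fun s => M s s).

(* tensor embedding h (on Z) |-> h ⊗ 1 (on Y), Z ⊆ Y *)
Definition restrict (Z : list Site) (s : Conf) : Conf :=
  fun x => if mem x Z then s x else 0%nat.
Definition embed (Z Y : list Site) (h : Op) : Op :=
  fun s t => if conf_eqb (minus Y Z) s t then h (restrict Z s) (restrict Z t) else C0.

Definition merge (Z : list Site) (s u : Conf) : Conf :=
  fun x => if mem x Z then u x else s x.
Definition ptrace d (Z : list Site) (M : Op) : Op :=
  fun s t => csum (confs d Z) (fun u => M (merge Z s u) (merge Z t u)).

Fixpoint oppow d Y (M : Op) (n : nat) : Op :=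
  match n with O => idop Y | S n' => opmul d Y M (oppow d Y M n') end.
Definition exp_partial d Y (M : Op) (n : nat) : Op :=
  fun s t => csum (seq 0 n) (fun k => Cscale (/ INR (fact k)) (oppow d Y M k s t)).
Definition Rlim (u : nat -> R) : R := epsilon (inhabits 0) (fun l => Un_cv u l).
Definition opexp d Y (M : Op) : Op :=
  fun s t => (Rlim (fun n => fst (exp_partial d Y M n s t)),
              Rlim (fun n => snd (exp_partial d Y M n s t))).

Definition gibbs d (beta : R) Y (Hm : Op) : Op :=
  let E := opexp d Y (opscale (- beta) Hm) in opscale (/ fst (trace d Y E)) E.

Definition Rsup (P : R -> Prop) : R := epsilon (inhabits 0) (fun m => is_lub P m).
Definition apply d Y (M : Op) (v : Vec) : Vec :=
  fun s => csum (confs d Y) (fun u => Cmul (M s u) (v u)).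
Definition vnorm d Y (v : Vec) : R :=
  sqrt (fold_right Rplus 0 (map (fun s => Cmod (v s) ^ 2) (confs d Y))).
Definition inner d Y (v w : Vec) : Cx :=
  csum (confs d Y) (fun s => Cmul (Cconj (v s)) (w s)).
Definition opnorm d Y (M : Op) : R :=
  Rsup (fun r => exists v, vnorm d Y v <= 1 /\ r = vnorm d Y (apply d Y M v)).
Definition hermitian d Y (M : Op) : Prop :=
  forall s t, In s (confs d Y) -> In t (confs d Y) -> M s t = Cconj (M t s).
Definition psd d Y (M : Op) : Prop :=
  hermitian d Y M /\ forall v, 0 <= fst (inner d Y v (apply d Y M v)).
Definition opsqrt d Y (P : Op) : Op :=
  epsilon (inhabits zero_op)
    (fun S => psd d Y S /\ forall s t, In s (confs d Y) -> In t (confs d Y) ->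
                                   opmul d Y S S s t = P s t).
Definition tnorm d Y (M : Op) : R := fst (trace d Y (opsqrt d Y (opmul d Y (adj M) M))).

Definition cov d X (sigma f g : Op) : R :=
  Cmod (Cadd (trace d X (opmul d X sigma (opmul d X f g)))
             (Copp (Cmul (trace d X (opmul d X sigma f)) (trace d X (opmul d X sigma g))))).

(* A Hamiltonian is a finite family of terms (Z, h^Z), h^Z acting on Z. *)
Definition Ham := list (list Site * Op).
Definition opsum (l : list Op) : Op := fold_right opadd zero_op l.
Definition HYon (H : Ham) (S W : list Site) : Op :=
  opsum (map (fun p => embed (fst p) W (snd p)) (filter (fun p => subl (fst p) S) H)).
Definition HY (H : Ham) (Y : list Site) : Op := HYon H Y Y.

Definition local_bounded (Lam : list Site) d (H : Ham) (k : nat) (J : R) : Prop :=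
  ForallOrdPairs (fun p q => ~ (incl (fst p) (fst q) /\ incl (fst q) (fst p))) H /\
  forall Z h, In (Z, h) H ->
    NoDup Z /\ Z <> [] /\ incl Z Lam /\ (length Z <= k)%nat /\ connected Z /\
    hermitian d Z h /\ opnorm d Z h <= J.

Definition region (Lam Y : list Site) : Prop := NoDup Y /\ incl Y Lam.

Definition uniformly_clustering (Lam : list Site) d (H : Ham) (beta : R) (eps : R -> R) : Prop :=
  forall X A B (l : R) (f g : Op),
    region Lam X -> NoDup A -> NoDup B -> incl A X -> incl B X -> 0 < l ->
    (forall a b, In a A -> In b B -> l <= sdist a b) ->
    hermitian d A f -> hermitian d B g ->
    cov d X (gibbs d beta X (HY H X)) (embed A X f) (embed B X g)
      <= opnorm d A f * opnorm d B g * eps l.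

(* belief-propagation error, gamma(l) = c1 e^{-c2 l}; ρ^{Y\{y}} is taken on the
   Hilbert space of Y (i.e. tensored with the maximally mixed state on y) *)
Definition belief_propagation (Lam : list Site) d (H : Ham) (beta c1 c2 ceta : R) : Prop :=
  forall Y y (l : R), region Lam Y -> In y Y -> 0 <= l ->
    exists e : Op,
      let eta := embed (ball Y y l) Y e in
      opnorm d Y (opmul d Y (adj eta) eta) <= ceta /\
      tnorm d Y (opsub (gibbs d beta Y (HYon H (remove1 Y y) Y))
                       (opmul d Y eta (opmul d Y (gibbs d beta Y (HY H Y)) (adj eta))))
        <= c1 * exp (- c2 * l).

(* Main.v *)
Require Import Defs.
From Stdlib Require Import Reals List ZArith.
From Stdlib Require Import Lra Lia Permutation FunctionalExtensionality Classical ClassicalEpsilon.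
From mathcomp Require all_boot all_algebra complex Rstruct.
Import ListNotations.
Open Scope R_scope.

(** The sites of the boundary of C are removed from X one at a time. Write
    rho' for the state after removing y, rho for the state before, f for an
    observable on A and eta for the belief-propagation operator around y, whose
    support is at distance at least l/2 from A. Up to gamma(l/2), tr(rho' f) is
    tr(eta rho eta^* f) = tr(rho f eta^* eta), which by clustering is
    tr(rho f) tr(rho eta^* eta) up to eps(l/2); and tr(rho eta^* eta) is 1 up to
    gamma(l/2), as rho' has trace 1. Once the whole boundary is gone, no
    interaction term meets both AB and the rest of C, so the Gibbs state
    factorizes and its restriction to A is that of rho^{AB}. The trace norm on A
    is attained at some f with f^2 = 1. *)

(** The observable [f] is fixed once, as the sign of the whole difference of reduced states on [A],
    before any site is removed. From then on only the real numbers tr(rho^Y f) are compared, so the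
    changing Hilbert spaces of the intermediate regions do no harm and no trace norm on [A] is
    estimated step by step. As f^2 = 1 survives tensoring with the identity, the norm of [f] and all
    its expectations in Gibbs states are at most 1, which keeps local dimensions out of the
    constant.

    Clustering must be uniform because it is applied in every intermediate region. The value l/2
    shares l equally between the radius of the belief-propagation ball and the gap left between that
    ball and [A]. Belief propagation keeps the Hilbert space of the removed site, in the maximally
    mixed state, so every removal ends by tracing that site out.

    Exponential and square root are defined by limits and choices. Both are evaluated in an
    eigenbasis, so products of exponential series are never handled. *)

Module Spectral.
#[warnings="-all"] Import all_boot all_algebra complex Rstruct.
Import GRing.Theory Num.Theory.
Local Open Scope ring_scope.
Local Open Scope sesquilinear_scope.

(** * The spectral theorem for Hermitian matrices, transported from MathComp *)

Definition toC (z : Cx) : R[i] := Complex (fst z) (snd z).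
Definition ofC (z : R[i]) : Cx := (complex.Re z, complex.Im z).

Lemma toCK z : ofC (toC z) = z. Proof. by case: z. Qed.
Lemma ofCK z : toC (ofC z) = z. Proof. by case: z. Qed.
Lemma toC_inj z w : toC z = toC w -> z = w.
Proof. by move=> e; rewrite -(toCK z) e toCK. Qed.
Lemma toCM z w : toC (Cmul z w) = toC z * toC w. Proof. by []. Qed.
Lemma toC_conj z : toC (Cconj z) = (toC z)^*. Proof. by []. Qed.

Lemma toC_csum n f : toC (csum (List.seq 0 n) f) = \sum_(k < n) toC (f k).
Proof.
change (List.seq 0 n) with (seq.iota 0 n).
rewrite -(big_mkord xpredT (fun k => toC (f k))) /index_iota subn0.
elim: (seq.iota 0 n) => [|a s IH]; first by rewrite big_nil.
by rewrite big_cons -IH.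
Qed.

(** The interface of the module: indices are bounded natural numbers and entries are pairs of reals,
    so that no MathComp matrix or complex number leaves it. Rows and columns of [U] are both
    declared orthonormal, which spares an argument on one-sided inverses later. *)
Lemma spectral_nat (n : nat) (A : nat -> nat -> Cx) :
  (forall i j, (i < n)%coq_nat -> (j < n)%coq_nat -> A i j = Cconj (A j i)) ->
  exists (U : nat -> nat -> Cx) (lam : nat -> R),
    [/\ forall i j, (i < n)%coq_nat -> (j < n)%coq_nat ->
          csum (List.seq 0 n) (fun k => Cmul (U i k) (Cconj (U j k))) =
          if Nat.eqb i j then Defs.C1 else Defs.C0,
        forall i j, (i < n)%coq_nat -> (j < n)%coq_nat ->
          csum (List.seq 0 n) (fun k => Cmul (Cconj (U k i)) (U k j)) =
          if Nat.eqb i j then Defs.C1 else Defs.C0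
      & forall i j, (i < n)%coq_nat -> (j < n)%coq_nat -> A i j =
          csum (List.seq 0 n)
            (fun k => Cscale (lam k) (Cmul (U i k) (Cconj (U j k))))].
Proof.
move=> hA.
(* Dimension 0 is separate because [inord], which turns a natural number into an index, needs a
   dimension of the form [n.+1]. *)
have [n0 | n_gt0] := posnP n.
  by exists (fun _ _ => Defs.C0), (fun _ => 0); split=> i j /ltP; rewrite n0 ltn0.
case: n n_gt0 hA => // n _ hA.
pose M : 'M[R[i]]_n.+1 := \matrix_(i, j) toC (A i j).
have hM : M \is hermsymmx.
  apply/is_hermitianmxP; rewrite expr0 scale1r; apply/matrixP => i j.
  by rewrite !mxE hA -?toC_conj //; apply/ltP.
have hN := hermitian_normalmx hM.
have /mxOverP hR := hermitian_spectral_diag_real hM.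
have eM := orthomx_spectralP hN.
have uS := spectral_unitarymx M.
set S := spectralmx M in eM uS; set D := spectral_diag M in eM hR.
have eS : invmx S = S^t* by exact: invmx_unitary.
have V1 : S *m S^t* = 1%:M by apply/unitarymxP.
have V2 : S^t* *m S = 1%:M by rewrite -eS mulVmx // unitarymx_unit.
have delta (i j : 'I_n.+1) :
    toC (if Nat.eqb i j then Defs.C1 else Defs.C0) = (i == j)%:R.
  case: (Nat.eqb_spec i j) => [/val_inj -> | ne]; first by rewrite eqxx.
  by case: (i =P j) => // e; case: ne; rewrite e.
(* MathComp gives M = S^-1 D S with [S] unitary, so the eigenvectors are the columns of the
   conjugate transpose of [S]. The entries of [D] are real by [hR], hence equal to their real
   parts. *)
exists (fun i k => ofC (S (inord k) (inord i))^*), (fun k => complex.Re (D 0 (inord k))).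
split=> i j /ltP hi /ltP hj; apply: toC_inj; rewrite toC_csum.
- have := congr1 (fun X : 'M_n.+1 => X (Ordinal hi) (Ordinal hj)) V2.
  rewrite /= [X in _ = X]mxE -delta /= => <-; rewrite mxE.
  apply: eq_bigr => k _.
  rewrite toCM toC_conj !ofCK conjCK inord_val !mxE.
  by congr ((S k _)^* * S k _); apply: val_inj; rewrite /= inordK.
- have := congr1 (fun X : 'M_n.+1 => X (Ordinal hi) (Ordinal hj)) V1.
  rewrite /= [X in _ = X]mxE -delta /= => <-; rewrite mxE.
  apply: eq_bigr => k _.
  rewrite toCM toC_conj !ofCK conjCK inord_val !mxE.
  by congr (S _ k * (S _ k)^*); apply: val_inj; rewrite /= inordK.
- have := congr1 (fun X : 'M_n.+1 => X (Ordinal hi) (Ordinal hj)) eM.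
  rewrite /= [X in X = _]mxE /= => ->; rewrite eS -mulmxA mxE.
  apply: eq_bigr => k _; rewrite mul_diag_mx !mxE.
  have -> z r : toC (Cscale r z) = Complex r 0 * toC z.
    by case: z => a b; rewrite /toC /Cscale /=; congr Complex;
       rewrite mul0r ?subr0 ?addr0.
  have -> : Complex (complex.Re (D 0 (inord k))) 0 = D 0 k.
    rewrite inord_val; have := hR 0 k; case: (D 0 k) => a b /=.
    by rewrite complex_real /= => /eqP ->.
  rewrite toCM toC_conj !ofCK conjCK inord_val mulrCA.
  by congr (_ * ((S k _)^* * S k _)); apply: val_inj; rewrite /= inordK.
Qed.
End Spectral.

Import Defs.

(** * Arithmetic of complex numbers as pairs of reals *)

Lemma Cx_ext (z w : Cx) : fst z = fst w -> snd z = snd w -> z = w.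
Proof. destruct z, w; simpl; intros -> ->; reflexivity. Qed.

Lemma Cx_ring : ring_theory C0 C1 Cadd Cmul (fun x y => Cadd x (Copp y)) Copp eq.
Proof. constructor; intros; apply Cx_ext; unfold C0, C1, Cadd, Cmul, Copp; simpl; ring. Qed.
Add Ring Cx_ring : Cx_ring.

Definition RtoC (r : R) : Cx := (r, 0).

Ltac cx := apply Cx_ext; unfold RtoC, Cconj, Cscale, C0, C1, Cadd, Cmul, Copp; simpl; try ring.

Lemma Cscale_mul r z : Cscale r z = Cmul (RtoC r) z. Proof. cx. Qed.
Lemma RtoC_mul a b : RtoC (a * b) = Cmul (RtoC a) (RtoC b). Proof. cx. Qed.
Lemma RtoC_add a b : RtoC (a + b) = Cadd (RtoC a) (RtoC b). Proof. cx. Qed.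
Lemma RtoC_inj a b : RtoC a = RtoC b -> a = b.
Proof. intros e. exact (f_equal fst e). Qed.
Lemma Cconj_mul z w : Cconj (Cmul z w) = Cmul (Cconj z) (Cconj w). Proof. cx. Qed.
Lemma Cconj_add z w : Cconj (Cadd z w) = Cadd (Cconj z) (Cconj w). Proof. cx. Qed.
Lemma Cconj_opp z : Cconj (Copp z) = Copp (Cconj z). Proof. cx. Qed.
Lemma Cconj_invol z : Cconj (Cconj z) = z. Proof. cx. Qed.
Lemma Cconj_RtoC r : Cconj (RtoC r) = RtoC r. Proof. cx. Qed.
Lemma Cconj_C0 : Cconj C0 = C0. Proof. cx. Qed.
Lemma Cconj_C1 : Cconj C1 = C1. Proof. cx. Qed.
Lemma Cconj_fixed_real z : z = Cconj z -> snd z = 0.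
Proof. intros e. apply (f_equal snd) in e. simpl in e. lra. Qed.
Lemma Cmod_sqr z : Cmod z ^ 2 = fst z ^ 2 + snd z ^ 2.
Proof. unfold Cmod. rewrite pow2_sqrt; [reflexivity | nra]. Qed.
Lemma Cmul_conj z : Cmul (Cconj z) z = RtoC (Cmod z ^ 2).
Proof. rewrite Cmod_sqr. cx. Qed.
Lemma Cmod_nonneg z : 0 <= Cmod z. Proof. apply sqrt_pos. Qed.
Lemma fst_le_Cmod z : Rabs (fst z) <= Cmod z.
Proof.
  unfold Cmod. rewrite <- (sqrt_Rsqr_abs (fst z)). apply sqrt_le_1_alt.
  unfold Rsqr. nra.
Qed.

(** * Finite complex and real sums over lists *)

Section Sums.
Context {S T : Type}.

Lemma csum_ext (l : list T) f g :
  (forall x, In x l -> f x = g x) -> csum l f = csum l g.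
Proof.
  induction l as [|a l IH]; simpl; intros H; [reflexivity|].
  rewrite H, IH; auto.
Qed.

Lemma csum_zero (l : list T) f : (forall x, In x l -> f x = C0) -> csum l f = C0.
Proof.
  induction l as [|a l IH]; simpl; intros H; [reflexivity|].
  rewrite H, IH by auto. ring.
Qed.

Lemma csum_add (l : list T) f g :
  csum l (fun x => Cadd (f x) (g x)) = Cadd (csum l f) (csum l g).
Proof. induction l as [|a l IH]; simpl; [|rewrite IH]; ring. Qed.

Lemma csum_mul_l (l : list T) a f :
  csum l (fun x => Cmul a (f x)) = Cmul a (csum l f).
Proof. induction l as [|b l IH]; simpl; [|rewrite IH]; ring. Qed.

Lemma csum_mul_r (l : list T) a f :
  csum l (fun x => Cmul (f x) a) = Cmul (csum l f) a.
Proof. induction l as [|b l IH]; simpl; [|rewrite IH]; ring. Qed.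

Lemma csum_opp (l : list T) f : csum l (fun x => Copp (f x)) = Copp (csum l f).
Proof. induction l as [|b l IH]; simpl; [|rewrite IH]; ring. Qed.

Lemma csum_conj (l : list T) f : csum l (fun x => Cconj (f x)) = Cconj (csum l f).
Proof. induction l as [|b l IH]; simpl; [cx|rewrite IH, Cconj_add]; ring. Qed.

Lemma csum_swap (l : list S) (m : list T) (f : S -> T -> Cx) :
  csum l (fun x => csum m (f x)) = csum m (fun y => csum l (fun x => f x y)).
Proof.
  induction l as [|a l IH]; simpl.
  - symmetry; apply csum_zero; reflexivity.
  - rewrite IH, <- csum_add. reflexivity.
Qed.

Lemma csum_map (g : S -> T) l f : csum (map g l) f = csum l (fun x => f (g x)).
Proof. induction l as [|a l IH]; simpl; [|rewrite IH]; reflexivity. Qed.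

Lemma csum_app (l m : list T) f : csum (l ++ m) f = Cadd (csum l f) (csum m f).
Proof. induction l as [|a l IH]; simpl; [|rewrite IH]; ring. Qed.

Lemma csum_flat_map (g : S -> list T) l f :
  csum (flat_map g l) f = csum l (fun x => csum (g x) f).
Proof. induction l as [|a l IH]; simpl; [|rewrite csum_app, IH]; reflexivity. Qed.

Lemma csum_perm (l m : list T) f : Permutation l m -> csum l f = csum m f.
Proof. induction 1; simpl; try congruence; ring. Qed.

Lemma csum_single (l : list T) x f :
  NoDup l -> In x l -> (forall y, In y l -> y <> x -> f y = C0) -> csum l f = f x.
Proof.
  intros nd hx hf.
  apply in_split in hx as (l1 & l2 & ->).
  assert (n := NoDup_remove_2 _ _ _ nd). rewrite in_app_iff in n.
  rewrite csum_app. simpl.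
  rewrite (csum_zero l1), (csum_zero l2); [ring| |];
    intros y hy; apply hf; try (rewrite in_app_iff; simpl; tauto); intros ->; tauto.
Qed.

Definition rsum (l : list T) (f : T -> R) : R := fold_right Rplus 0 (map f l).

Lemma csum_RtoC (l : list T) f : csum l (fun x => RtoC (f x)) = RtoC (rsum l f).
Proof.
  induction l as [|a l IH]; [reflexivity|].
  unfold rsum in *; simpl. rewrite IH, RtoC_add. reflexivity.
Qed.

Lemma fst_csum (l : list T) f : fst (csum l f) = rsum l (fun x => fst (f x)).
Proof. unfold rsum. induction l as [|a l IH]; simpl; [|rewrite IH]; reflexivity. Qed.

Lemma snd_csum (l : list T) f : snd (csum l f) = rsum l (fun x => snd (f x)).
Proof. unfold rsum. induction l as [|a l IH]; simpl; [|rewrite IH]; reflexivity. Qed.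

Lemma rsum_le (l : list T) f g :
  (forall x, In x l -> f x <= g x) -> rsum l f <= rsum l g.
Proof.
  unfold rsum. induction l as [|a l IH]; simpl; intros H; [lra|].
  apply Rplus_le_compat; auto.
Qed.

Lemma rsum_ext (l : list T) f g :
  (forall x, In x l -> f x = g x) -> rsum l f = rsum l g.
Proof.
  unfold rsum. induction l as [|a l IH]; simpl; intros H; [reflexivity|].
  rewrite H, IH; auto.
Qed.

Lemma rsum_nonneg (l : list T) f : (forall x, In x l -> 0 <= f x) -> 0 <= rsum l f.
Proof.
  unfold rsum. induction l as [|a l IH]; simpl; intros H; [lra|].
  apply Rplus_le_le_0_compat; auto.
Qed.

Lemma rsum_app (l m : list T) f : rsum (l ++ m) f = rsum l f + rsum m f.
Proof. unfold rsum. induction l as [|a l IH]; simpl; [|rewrite IH]; ring. Qed.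

Lemma rsum_mul_l (l : list T) a f : rsum l (fun x => a * f x) = a * rsum l f.
Proof. unfold rsum. induction l as [|b l IH]; simpl; [|rewrite IH]; ring. Qed.

Lemma rsum_ge_term (l : list T) x f :
  In x l -> (forall y, In y l -> 0 <= f y) -> f x <= rsum l f.
Proof.
  unfold rsum. induction l as [|a l IH]; simpl; [tauto|]; intros [->|hx] H.
  - pose proof (rsum_nonneg l f (fun y hy => H y (or_intror hy))). unfold rsum in *. lra.
  - specialize (IH hx (fun y hy => H y (or_intror hy))).
    specialize (H a (or_introl eq_refl)). lra.
Qed.

Lemma rsum_abs (l : list T) f : Rabs (rsum l f) <= rsum l (fun x => Rabs (f x)).
Proof.
  unfold rsum. induction l as [|a l IH]; simpl; [rewrite Rabs_R0; lra|].
  eapply Rle_trans; [apply Rabs_triang|lra].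
Qed.

Lemma rsum_cv (l : list T) (u : T -> nat -> R) (v : T -> R) :
  (forall x, In x l -> Un_cv (u x) (v x)) ->
  Un_cv (fun n => rsum l (fun x => u x n)) (rsum l v).
Proof.
  unfold rsum. induction l as [|a l IH]; simpl; intros H.
  - intros e he; exists 0%nat; intros; unfold Rdist; rewrite Rminus_diag, Rabs_R0; lra.
  - apply CV_plus; auto.
Qed.

End Sums.

Lemma csum_prod {S T} (l : list S) (m : list T) f g :
  csum l (fun x => csum m (fun y => Cmul (f x) (g y))) = Cmul (csum l f) (csum m g).
Proof.
  rewrite <- csum_mul_r. apply csum_ext; intros x _. apply csum_mul_l.
Qed.

(** * Configurations *)

(** The value 0 off [Y] makes every basis state a unique function, so that two configurations
    agreeing on [Y] are equal. *)
Lemma in_confs d Y c : NoDup Y ->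
  In c (confs d Y) <->
  (forall x, In x Y -> (c x < d x)%nat) /\ (forall x, ~ In x Y -> c x = 0%nat).
Proof.
  revert c. induction Y as [|y Y IH]; intros c nd; simpl.
  - split.
    + intros [<-|[]]; split; [contradiction|reflexivity].
    + intros [_ h]. left. apply functional_extensionality; intros x.
      symmetry; apply h; tauto.
  - inversion nd as [|? ? hy nd']; subst.
    rewrite in_flat_map. split.
    + intros (c' & hc' & hc). apply in_map_iff in hc as (i & <- & hi).
      apply in_seq in hi. apply IH in hc' as [h1 h2]; [|assumption].
      unfold upd. split; intros x hx; destruct (site_eq_dec x y) as [->|ne].
      * lia.
      * apply h1. destruct hx; [congruence|assumption].
      * tauto.
      * apply h2; tauto.
    + intros [h1 h2]. exists (upd c y 0%nat). split.
      * apply IH; [assumption|]. unfold upd.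
        split; intros x hx; destruct (site_eq_dec x y) as [->|ne]; auto; try tauto.
        apply h2; intros [?|?]; [congruence|tauto].
      * apply in_map_iff. exists (c y). split.
        -- apply functional_extensionality; intros x. unfold upd.
           destruct (site_eq_dec x y) as [->|]; reflexivity.
        -- apply in_seq. specialize (h1 y (or_introl eq_refl)). lia.
Qed.

(** The common form of two enumerations: adding one site to a region, and joining the configurations
    of two complementary regions. *)
Lemma NoDup_product {S T V} (f : S -> T -> V) (l : list S) (m : S -> list T) :
  NoDup l -> (forall x, In x l -> NoDup (m x)) ->
  (forall x y x' y', In x l -> In y (m x) -> In x' l -> In y' (m x') ->
     f x y = f x' y' -> x = x' /\ y = y') ->
  NoDup (flat_map (fun x => map (f x) (m x)) l).
Proof.
  induction l as [|a l IH]; simpl; intros nl nm inj; [constructor|].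
  inversion nl; subst. apply NoDup_app.
  - assert (nd := nm a (or_introl eq_refl)).
    assert (ij : forall y y', In y (m a) -> In y' (m a) -> f a y = f a y' -> y = y')
      by (intros y y' h h' e; apply (inj a y a y') in e; tauto).
    clear - nd ij. induction (m a) as [|b k IHk]; simpl; constructor.
    + inversion nd; subst. intros h. apply in_map_iff in h as (y & e & hy).
      apply ij in e; simpl; auto. subst; contradiction.
    + inversion nd; subst. apply IHk; simpl in *; auto.
  - apply IH; auto.
  - intros v h1 h2. apply in_map_iff in h1 as (y & <- & hy).
    apply in_flat_map in h2 as (x & hx & h). apply in_map_iff in h as (y' & e & hy').
    destruct (inj x y' a y) as [-> _]; auto.
Qed.

Lemma NoDup_confs d Y : NoDup Y -> NoDup (confs d Y).
Proof.
  induction Y as [|y Y IH]; simpl; intros nd.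
  - constructor; [simpl; tauto|constructor].
  - inversion nd; subst.
    apply (NoDup_product (fun c i => upd c y i)); auto using seq_NoDup.
    intros c i c' i' hc _ hc' _ e.
    apply in_confs in hc as [_ hc]; [|assumption].
    apply in_confs in hc' as [_ hc']; [|assumption].
    split.
    + apply functional_extensionality; intros x.
      apply (f_equal (fun g => g x)) in e. unfold upd in e.
      destruct (site_eq_dec x y) as [->|]; [|assumption].
      rewrite hc, hc'; auto.
    + apply (f_equal (fun g => g y)) in e. unfold upd in e.
      destruct (site_eq_dec y y); congruence.
Qed.

Lemma mem_In x Y : mem x Y = true <-> In x Y.
Proof. unfold mem. destruct (in_dec site_eq_dec x Y); split; intuition congruence. Qed.

Lemma In_minus x Y Z : In x (minus Y Z) <-> In x Y /\ ~ In x Z.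
Proof.
  unfold minus. rewrite filter_In. rewrite <- (mem_In x Z).
  destruct (mem x Z); simpl; intuition congruence.
Qed.

Lemma conf_eqb_spec Y s t : conf_eqb Y s t = true <-> forall x, In x Y -> s x = t x.
Proof.
  unfold conf_eqb. rewrite forallb_forall.
  split; intros h x hx; [apply Nat.eqb_eq|apply Nat.eqb_eq]; auto.
Qed.

Lemma conf_ext d Y s t : NoDup Y -> In s (confs d Y) -> In t (confs d Y) ->
  (forall x, In x Y -> s x = t x) -> s = t.
Proof.
  intros nd hs ht h. apply in_confs in hs as [_ hs], ht as [_ ht]; auto.
  apply functional_extensionality; intros x.
  destruct (in_dec site_eq_dec x Y); [auto|]. rewrite hs, ht; auto.
Qed.

Lemma idop_eq Y s : idop Y s s = C1.
Proof.
  unfold idop. destruct (conf_eqb Y s s) eqn:e; [reflexivity|].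
  rewrite <- Bool.not_true_iff_false, conf_eqb_spec in e. exfalso; auto.
Qed.

Lemma idop_neq d Y s t : NoDup Y -> In s (confs d Y) -> In t (confs d Y) ->
  s <> t -> idop Y s t = C0.
Proof.
  intros nd hs ht ne. unfold idop. destruct (conf_eqb Y s t) eqn:e; [|reflexivity].
  rewrite conf_eqb_spec in e. exfalso. eauto using conf_ext.
Qed.

Lemma idop_sym Y s t : idop Y s t = idop Y t s.
Proof.
  unfold idop.
  destruct (conf_eqb Y s t) eqn:e, (conf_eqb Y t s) eqn:e'; try reflexivity;
    rewrite <- Bool.not_true_iff_false, conf_eqb_spec in *; exfalso;
    match goal with h : ~ _ |- _ => apply h end; intros; symmetry; auto.
Qed.

Lemma Cconj_idop Y s t : Cconj (idop Y s t) = idop Y s t.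
Proof. unfold idop. destruct (conf_eqb Y s t); cx. Qed.

Lemma csum_idop_l d Y s f : NoDup Y -> In s (confs d Y) ->
  csum (confs d Y) (fun u => Cmul (idop Y s u) (f u)) = f s.
Proof.
  intros nd hs. rewrite (csum_single _ s); auto using NoDup_confs.
  - rewrite idop_eq. ring.
  - intros u hu ne. rewrite (idop_neq d) by auto. ring.
Qed.

Lemma csum_idop_r d Y t f : NoDup Y -> In t (confs d Y) ->
  csum (confs d Y) (fun u => Cmul (f u) (idop Y u t)) = f t.
Proof.
  intros nd ht. rewrite <- (csum_idop_l d Y t f nd ht).
  apply csum_ext; intros u _. rewrite (idop_sym Y u t). ring.
Qed.

(** Only membership is compared, not the order of the lists, so [Y] may be [S ++ T] as well as any
    rearrangement of it. *)
Definition split_region (Y S T : list Site) : Prop :=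
  NoDup Y /\ NoDup S /\ NoDup T /\
  (forall x, In x Y <-> In x S \/ In x T) /\ (forall x, In x S -> ~ In x T).

Lemma split_minus Y Z : NoDup Y -> NoDup Z -> incl Z Y -> split_region Y Z (minus Y Z).
Proof.
  intros ny nz h. unfold split_region.
  split; [assumption|split; [assumption|split; [apply NoDup_filter; assumption|split]]];
    intros x; rewrite In_minus; [|tauto].
  specialize (h x). destruct (in_dec site_eq_dec x Z); tauto.
Qed.

Lemma split_sym Y S T : split_region Y S T -> split_region Y T S.
Proof.
  intros (h1 & h2 & h3 & h4 & h5). unfold split_region.
  split; [assumption|split; [assumption|split; [assumption|split]]];
    intros x; [rewrite h4; tauto|]. specialize (h5 x). tauto.
Qed.

Lemma merge_confs d Y S T s t : split_region Y S T ->
  In s (confs d S) -> In t (confs d T) -> In (merge T s t) (confs d Y).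
Proof.
  intros (h1 & h2 & h3 & h4 & h5) hs ht.
  apply in_confs in hs as [s1 s2], ht as [t1 t2]; auto.
  apply in_confs; [assumption|]. unfold merge.
  split; intros x hx; destruct (mem x T) eqn:e;
    try (apply mem_In in e); try (rewrite <- Bool.not_true_iff_false, mem_In in e).
  - auto.
  - apply h4 in hx. apply s1; tauto.
  - exfalso; apply hx, h4; auto.
  - apply s2. intros h; apply hx, h4; auto.
Qed.

Lemma restrict_confs d Y S s : NoDup Y -> NoDup S -> incl S Y ->
  In s (confs d Y) -> In (restrict S s) (confs d S).
Proof.
  intros ny ns h hs. apply in_confs in hs as [s1 s2]; [|assumption].
  apply in_confs; [assumption|]. unfold restrict.
  split; intros x hx; destruct (mem x S) eqn:e;
    try (apply mem_In in e); try (rewrite <- Bool.not_true_iff_false, mem_In in e); auto; tauto.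
Qed.

Lemma restrict_merge_l d Y S T s t : split_region Y S T -> In s (confs d S) ->
  restrict S (merge T s t) = s.
Proof.
  intros (h1 & h2 & h3 & h4 & h5) hs. apply in_confs in hs as [_ s2]; [|assumption].
  apply functional_extensionality; intros x. unfold restrict, merge.
  destruct (mem x S) eqn:e.
  - apply mem_In in e. destruct (mem x T) eqn:e'; [|reflexivity].
    apply mem_In in e'. exfalso; eapply h5; eauto.
  - rewrite <- Bool.not_true_iff_false, mem_In in e. symmetry; auto.
Qed.

Lemma restrict_merge_r d T s t : NoDup T -> In t (confs d T) ->
  restrict T (merge T s t) = t.
Proof.
  intros nt ht. apply in_confs in ht as [_ t2]; [|assumption].
  apply functional_extensionality; intros x. unfold restrict, merge.
  destruct (mem x T) eqn:e; [reflexivity|].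
  rewrite <- Bool.not_true_iff_false, mem_In in e. symmetry; auto.
Qed.

Lemma merge_restrict d Y S T c : split_region Y S T -> In c (confs d Y) ->
  merge T (restrict S c) (restrict T c) = c.
Proof.
  intros (h1 & h2 & h3 & h4 & h5) hc. apply in_confs in hc as [_ c2]; [|assumption].
  apply functional_extensionality; intros x. unfold restrict, merge.
  destruct (mem x T) eqn:e; [reflexivity|].
  destruct (mem x S) eqn:e'; [reflexivity|].
  rewrite <- Bool.not_true_iff_false, mem_In in *. symmetry; apply c2.
  rewrite h4; tauto.
Qed.

(** The Hilbert space of [Y] is the tensor product of those of [S] and [T], seen on basis labels.
    The two enumerations are duplicate-free with the same elements, hence permutations of each
    other. *)
Lemma csum_split d Y S T F : split_region Y S T ->
  csum (confs d Y) F =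
  csum (confs d S) (fun s => csum (confs d T) (fun t => F (merge T s t))).
Proof.
  intros hsp. assert (h := hsp). destruct h as (h1 & h2 & h3 & h4 & h5).
  transitivity (csum (flat_map (fun s => map (merge T s) (confs d T)) (confs d S)) F).
  - apply csum_perm, NoDup_Permutation.
    + apply NoDup_confs; assumption.
    + apply NoDup_product; auto using NoDup_confs.
      intros s t s' t' hs ht hs' ht' e. split.
      * rewrite <- (restrict_merge_l d Y S T s t hsp hs), e.
        apply (restrict_merge_l d Y); auto.
      * rewrite <- (restrict_merge_r d T s t h3 ht), e.
        apply (restrict_merge_r d); auto.
    + intros c. rewrite in_flat_map. split.
      * intros hc. exists (restrict S c). split.
        -- apply (restrict_confs d Y); auto. intros x hx; apply h4; auto.
        -- apply in_map_iff. exists (restrict T c). split.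
           ++ apply (merge_restrict d Y); auto.
           ++ apply (restrict_confs d Y); auto. intros x hx; apply h4; auto.
      * intros (s & hs & h). apply in_map_iff in h as (t & <- & ht).
        apply (merge_confs d Y S T); auto.
  - rewrite csum_flat_map. apply csum_ext; intros s _. apply csum_map.
Qed.

(** Reduces a claim about entries to product basis states, where [embed] and [idop] factor. *)
Lemma merge_cases d Y S T (P : Conf -> Prop) : split_region Y S T ->
  (forall s t, In s (confs d S) -> In t (confs d T) -> P (merge T s t)) ->
  forall c, In c (confs d Y) -> P c.
Proof.
  intros hsp h c hc. assert (h' := hsp). destruct h' as (h1 & h2 & h3 & h4 & h5).
  rewrite <- (merge_restrict d Y S T c hsp hc).
  apply h; apply (restrict_confs d Y); auto; intros x hx; apply h4; auto.
Qed.

Lemma idop_merge d Y S T s t s' t' : split_region Y S T ->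
  In s (confs d S) -> In t (confs d T) -> In s' (confs d S) -> In t' (confs d T) ->
  idop Y (merge T s t) (merge T s' t') = Cmul (idop S s s') (idop T t t').
Proof.
  intros hsp hs ht hs' ht'. assert (h := hsp). destruct h as (h1 & h2 & h3 & h4 & h5).
  destruct (classic (s = s')) as [->|ne].
  - rewrite (idop_eq S). destruct (classic (t = t')) as [->|ne].
    + rewrite !idop_eq. ring.
    + rewrite (idop_neq d T) by auto. rewrite (idop_neq d Y); auto.
      * ring.
      * apply (merge_confs d Y S T); auto.
      * apply (merge_confs d Y S T); auto.
      * intros e; apply ne.
        rewrite <- (restrict_merge_r d T s' t h3 ht), e. apply (restrict_merge_r d); auto.
  - rewrite (idop_neq d S) by auto. rewrite (idop_neq d Y); auto.
    + ring.
    + apply (merge_confs d Y S T); auto.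
    + apply (merge_confs d Y S T); auto.
    + intros e; apply ne.
      rewrite <- (restrict_merge_l d Y S T s t hsp hs), e. apply (restrict_merge_l d Y); auto.
Qed.

(** The matrix of h tensor 1 in the product basis. *)
Lemma embed_merge d Y S T h s t s' t' : split_region Y S T ->
  In s (confs d S) -> In t (confs d T) -> In s' (confs d S) -> In t' (confs d T) ->
  embed S Y h (merge T s t) (merge T s' t') = Cmul (h s s') (idop T t t').
Proof.
  intros hsp hs ht hs' ht'. assert (h' := hsp). destruct h' as (h1 & h2 & h3 & h4 & h5).
  unfold embed. rewrite !(restrict_merge_l d Y S T) by auto.
  assert (e : conf_eqb (minus Y S) (merge T s t) (merge T s' t') = conf_eqb T t t').
  { apply Bool.eq_iff_eq_true. rewrite !conf_eqb_spec. unfold merge.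
    split; intros h' x hx.
    - assert (hm : In x (minus Y S)).
      { apply In_minus. split; [apply h4; auto|]. intros hxs; exact (h5 x hxs hx). }
      apply h' in hm. rewrite (proj2 (mem_In x T) hx) in hm. assumption.
    - apply In_minus in hx as [hx1 hx2]. apply h4 in hx1.
      assert (hT : In x T) by tauto.
      rewrite (proj2 (mem_In x T) hT). auto. }
  rewrite e. unfold idop. destruct (conf_eqb T t t'); ring.
Qed.

(** * Spectral decomposition *)

(** Completeness and orthonormality of the columns are both part of the definition, so neither has
    to be derived from the other by a dimension count. *)
Definition unitary (d : Site -> nat) (Y : list Site) (U : Op) : Prop :=
  (forall s t, In s (confs d Y) -> In t (confs d Y) ->
     csum (confs d Y) (fun i => Cmul (U s i) (Cconj (U t i))) = idop Y s t) /\
  (forall i j, In i (confs d Y) -> In j (confs d Y) ->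
     csum (confs d Y) (fun s => Cmul (Cconj (U s i)) (U s j)) = idop Y i j).

Definition diag_op d Y (U : Op) (lam : Conf -> R) : Op :=
  fun s t => csum (confs d Y)
    (fun i => Cmul (RtoC (lam i)) (Cmul (U s i) (Cconj (U t i)))).

(* Eigenvectors are indexed by the configurations themselves: [U s i] is the
   [s]-component of the [i]-th eigenvector. *)
Definition specdec d Y (M : Op) (U : Op) (lam : Conf -> R) : Prop :=
  unitary d Y U /\
  forall s t, In s (confs d Y) -> In t (confs d Y) -> M s t = diag_op d Y U lam s t.

(** A numbering of the basis states, by which the matrix statement of [spectral_nat] is carried over
    to operators indexed by configurations. *)
Lemma list_index {T} (l : list T) (x0 : T) : NoDup l ->
  exists idx : T -> nat,
    (forall x, In x l -> (idx x < length l)%nat /\ nth (idx x) l x0 = x) /\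
    (forall k, (k < length l)%nat -> idx (nth k l x0) = k).
Proof.
  intros nd.
  assert (h : forall x, exists k, In x l -> (k < length l)%nat /\ nth k l x0 = x).
  { intros x. destruct (classic (In x l)) as [hx|hx].
    - apply (In_nth _ _ x0) in hx as (k & hk). exists k; auto.
    - exists 0%nat; tauto. }
  exists (fun x => proj1_sig (constructive_indefinite_description _ (h x))).
  assert (h' : forall x, In x l ->
    let k := proj1_sig (constructive_indefinite_description _ (h x)) in
    (k < length l)%nat /\ nth k l x0 = x).
  { intros x hx. destruct (constructive_indefinite_description _ (h x)); simpl; auto. }
  split; [assumption|]. intros k hk.
  destruct (h' (nth k l x0) (nth_In _ _ hk)) as [h1 h2].
  rewrite NoDup_nth in nd. apply nd; eauto.
Qed.

Lemma csum_nth {T} (l : list T) (x0 : T) f :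
  csum l f = csum (seq 0 (length l)) (fun k => f (nth k l x0)).
Proof.
  rewrite <- (csum_map (fun k => nth k l x0)). f_equal. symmetry.
  induction l as [|a l IH]; simpl; [reflexivity|].
  f_equal. rewrite <- seq_shift, map_map. exact IH.
Qed.

Lemma spectral d Y M : NoDup Y -> hermitian d Y M -> exists U lam, specdec d Y M U lam.
Proof.
  intros ny hM. set (L := confs d Y).
  assert (nl : NoDup L) by (apply NoDup_confs; assumption).
  set (z := fun _ : Site => 0%nat : nat).
  destruct (list_index L z nl) as (idx & hx & hk).
  destruct (Spectral.spectral_nat (length L) (fun i j => M (nth i L z) (nth j L z)))
    as (U & lam & [h1 h2 h3]).
  { intros i j hi hj. apply hM; apply nth_In; assumption. }
  assert (hd : forall s t, In s L -> In t L ->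
    (if Nat.eqb (idx s) (idx t) then C1 else C0) = idop Y s t).
  { intros s t hs ht. destruct (Nat.eqb_spec (idx s) (idx t)) as [e|ne].
    - apply hx in hs as [_ hs], ht as [_ ht]. rewrite <- hs, <- ht, e, idop_eq. reflexivity.
    - rewrite (idop_neq d); auto. congruence. }
  exists (fun s i => U (idx s) (idx i)), (fun i => lam (idx i)).
  assert (seqlt : forall k n, In k (seq 0 n) -> (k < n)%nat) by (intros k n; rewrite in_seq; lia).
  repeat split; unfold diag_op; fold L; intros s t hs ht;
    try rewrite <- (hd s t hs ht);
    destruct (hx s hs) as [bs es], (hx t ht) as [bt et]; rewrite (csum_nth L z).
  - rewrite <- (h1 _ _ bs bt). apply csum_ext; intros k ik. rewrite hk; auto.
  - rewrite <- (h2 _ _ bs bt). apply csum_ext; intros k ik. rewrite hk; auto.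
  - rewrite <- es at 1. rewrite <- et at 1. rewrite (h3 _ _ bs bt).
    apply csum_ext; intros k ik. rewrite hk by auto. apply Cscale_mul.
Qed.

(** * Functional calculus in a fixed eigenbasis, up to the Gibbs state *)

Section Spec.
Context (d : Site -> nat) (Y : list Site) (ny : NoDup Y).
Notation L := (confs d Y).

Lemma specdec_ext M N U lam mu : specdec d Y M U lam ->
  (forall s t, In s L -> In t L -> N s t = M s t) -> (forall i, In i L -> lam i = mu i) ->
  specdec d Y N U mu.
Proof.
  intros [hU hM] h e. split; [assumption|]. intros s t hs ht. rewrite h, hM by assumption.
  apply csum_ext; intros i hi. rewrite e; auto.
Qed.

Lemma specdec_herm M U lam : specdec d Y M U lam -> hermitian d Y M.
Proof.
  intros [_ hM] s t hs ht. rewrite !hM by assumption. unfold diag_op.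
  rewrite <- csum_conj. apply csum_ext; intros i _.
  rewrite !Cconj_mul, Cconj_RtoC, Cconj_invol. ring.
Qed.

Lemma specdec_idop U : unitary d Y U -> specdec d Y (idop Y) U (fun _ => 1).
Proof.
  intros hU. split; [assumption|]. intros s t hs ht. rewrite <- (proj1 hU) by assumption.
  apply csum_ext; intros i _. cx.
Qed.

Lemma specdec_scale r M U lam : specdec d Y M U lam ->
  specdec d Y (opscale r M) U (fun i => r * lam i).
Proof.
  intros [hU hM]. split; [assumption|]. intros s t hs ht.
  unfold opscale. rewrite hM, Cscale_mul by assumption. unfold diag_op.
  rewrite <- csum_mul_l. apply csum_ext; intros i _. rewrite RtoC_mul. ring.
Qed.

Lemma specdec_mul M N U lam mu : specdec d Y M U lam -> specdec d Y N U mu ->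
  specdec d Y (opmul d Y M N) U (fun i => lam i * mu i).
Proof.
  intros [hU hM] [_ hN]. split; [assumption|]. intros s t hs ht.
  transitivity (csum L (fun u => csum L (fun i => csum L (fun j =>
    Cmul (Cmul (RtoC (lam i * mu j)) (Cmul (U s i) (Cconj (U t j))))
         (Cmul (Cconj (U u i)) (U u j)))))).
  { apply csum_ext; intros u hu. rewrite hM, hN by assumption. unfold diag_op.
    rewrite <- csum_prod. apply csum_ext; intros i _. apply csum_ext; intros j _.
    rewrite RtoC_mul. ring. }
  rewrite csum_swap. apply csum_ext; intros i hi. rewrite csum_swap.
  (* Orthonormality of the eigenvectors collapses the sum over [j]; the target is first written as
     such a sum against the identity. *)
  rewrite <- (csum_idop_r d Y i
    (fun j => Cmul (RtoC (lam i * mu j)) (Cmul (U s i) (Cconj (U t j))))) by assumption.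
  apply csum_ext; intros j hj. rewrite csum_mul_l, (proj2 hU), (idop_sym Y i j) by assumption.
  reflexivity.
Qed.

Lemma specdec_trace M U lam : specdec d Y M U lam -> trace d Y M = RtoC (rsum L lam).
Proof.
  intros [hU hM]. unfold trace. rewrite <- csum_RtoC.
  transitivity (csum L (fun s => csum L (fun i =>
    Cmul (RtoC (lam i)) (Cmul (Cconj (U s i)) (U s i))))).
  { apply csum_ext; intros s hs. rewrite hM by assumption. apply csum_ext; intros i _. ring. }
  rewrite csum_swap. apply csum_ext; intros i hi.
  rewrite csum_mul_l, (proj2 hU), idop_eq by assumption. ring.
Qed.

Lemma specdec_oppow M U lam n : specdec d Y M U lam ->
  specdec d Y (oppow d Y M n) U (fun i => lam i ^ n).
Proof.
  intros hM. induction n as [|n IH]; simpl.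
  - apply specdec_idop, hM.
  - apply (specdec_mul M); assumption.
Qed.

Lemma exp_series_cv x :
  Un_cv (fun n => rsum (seq 0 n) (fun k => / INR (fact k) * x ^ k)) (exp x).
Proof.
  intros e he. destruct (proj2_sig (exist_exp x) e he) as [N hN].
  (* [sum_f_R0 _ n] has n+1 terms while [seq 0 n] has n, hence the shift. *)
  exists (S N). intros n hn. destruct n as [|n]; [lia|].
  replace (rsum _ _) with (sum_f_R0 (fun k => / INR (fact k) * x ^ k) n).
  - apply hN. lia.
  - clear. induction n as [|n IH]; [unfold rsum; simpl; ring|].
    rewrite tech5, IH, (seq_S (S n)), rsum_app. unfold rsum at 3; simpl. ring.
Qed.

(** [Rlim] is a choice, so it can be evaluated only after a limit has been exhibited; uniqueness of
    limits does the rest. *)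
Lemma Rlim_eq u l : Un_cv u l -> Rlim u = l.
Proof.
  intros h. apply (UL_sequence u); [|assumption].
  unfold Rlim. apply epsilon_spec. exists l; assumption.
Qed.

(** An entry of a partial sum is a finite combination, over the eigenvectors, of scalar exponential
    series; their convergence gives that of the entry. *)
Lemma specdec_opexp M U lam : specdec d Y M U lam ->
  specdec d Y (opexp d Y M) U (fun i => exp (lam i)).
Proof.
  intros hM. split; [apply hM|]. intros s t hs ht.
  set (w := fun i => Cmul (U s i) (Cconj (U t i))).
  set (p := fun i n => rsum (seq 0 n) (fun k => / INR (fact k) * lam i ^ k)).
  assert (hp : forall n, exp_partial d Y M n s t = csum L (fun i => Cmul (RtoC (p i n)) (w i))).
  { intros n. unfold exp_partial.
    transitivity (csum (seq 0 n) (fun k => csum L (fun i =>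
      Cmul (RtoC (/ INR (fact k) * lam i ^ k)) (w i)))).
    - apply csum_ext; intros k _.
      rewrite (proj2 (specdec_oppow M U lam k hM)), Cscale_mul by assumption.
      unfold diag_op. rewrite <- csum_mul_l. apply csum_ext; intros i _.
      unfold w. rewrite RtoC_mul. ring.
    - rewrite csum_swap. apply csum_ext; intros i _.
      rewrite csum_mul_r, csum_RtoC. reflexivity. }
  assert (cv : forall q : Conf -> R, Un_cv (fun n => rsum L (fun i => p i n * q i))
                          (rsum L (fun i => exp (lam i) * q i))).
  { intros q. apply rsum_cv. intros i _. apply (CV_mult _ (fun _ => q i)).
    - apply exp_series_cv.
    - intros e he; exists 0%nat; intros; unfold Rdist; rewrite Rminus_diag, Rabs_R0; lra. }
  unfold diag_op. apply Cx_ext; [rewrite fst_csum | rewrite snd_csum]; simpl; apply Rlim_eq.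
  - eapply Un_cv_ext; [|eapply eq_ind; [apply (cv (fun i => fst (w i)))|]].
    + intros n. simpl. rewrite hp, fst_csum. apply rsum_ext; intros i _. simpl. ring.
    + apply rsum_ext; intros i _. simpl. ring.
  - eapply Un_cv_ext; [|eapply eq_ind; [apply (cv (fun i => snd (w i)))|]].
    + intros n. simpl. rewrite hp, snd_csum. apply rsum_ext; intros i _. simpl. ring.
    + apply rsum_ext; intros i _. simpl. ring.
Qed.

Definition gibbs_weight (beta : R) (lam : Conf -> R) (i : Conf) : R :=
  / rsum L (fun j => exp (- beta * lam j)) * exp (- beta * lam i).

Lemma specdec_gibbs beta M U lam : specdec d Y M U lam ->
  specdec d Y (gibbs d beta Y M) U (gibbs_weight beta lam).
Proof.
  intros hM. apply (specdec_scale (- beta)), specdec_opexp in hM.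
  unfold gibbs. rewrite (specdec_trace _ _ _ hM). apply specdec_scale. exact hM.
Qed.

Hypothesis L_nonempty : L <> [].

Lemma partition_pos (f : Conf -> R) : 0 < rsum L (fun j => exp (f j)).
Proof.
  destruct L as [|c l]; [contradiction|]. unfold rsum; simpl.
  pose proof (exp_pos (f c)).
  pose proof (rsum_nonneg l (fun j => exp (f j)) (fun j _ => Rlt_le _ _ (exp_pos _))).
  unfold rsum in *. lra.
Qed.

Lemma gibbs_weight_pos beta lam i : 0 < gibbs_weight beta lam i.
Proof.
  unfold gibbs_weight. apply Rmult_lt_0_compat; [|apply exp_pos].
  apply Rinv_0_lt_compat, partition_pos.
Qed.

Lemma gibbs_weight_sum beta lam : rsum L (gibbs_weight beta lam) = 1.
Proof.
  unfold gibbs_weight. rewrite rsum_mul_l. apply Rinv_l.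
  pose proof (partition_pos (fun j => - beta * lam j)). lra.
Qed.

End Spec.

(** * Trace norm and its dual characterization *)

(** Observables with values 1 and -1. They preserve the inner square of vectors, and both bounds
    used later, on the operator norm and on expectations, come from that. *)
Definition involution (d : Site -> nat) (Y : list Site) (F : Op) : Prop :=
  hermitian d Y F /\
  forall s t, In s (confs d Y) -> In t (confs d Y) -> opmul d Y F F s t = idop Y s t.

Section Norms.
Context (d : Site -> nat) (Y : list Site) (ny : NoDup Y).
Notation L := (confs d Y).

Lemma inner_ext v v' w w' :
  (forall s, In s L -> v s = v' s) -> (forall s, In s L -> w s = w' s) ->
  inner d Y v w = inner d Y v' w'.
Proof. intros h h'. apply csum_ext; intros s hs. rewrite h, h'; auto. Qed.

Lemma apply_opmul M N v s : apply d Y (opmul d Y M N) v s = apply d Y M (apply d Y N v) s.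
Proof.
  unfold apply, opmul.
  transitivity (csum L (fun u => csum L (fun x => Cmul (M s x) (Cmul (N x u) (v u))))).
  - apply csum_ext; intros u _. rewrite <- csum_mul_r. apply csum_ext; intros x _. ring.
  - rewrite csum_swap. apply csum_ext; intros x _. apply csum_mul_l.
Qed.

Lemma apply_idop M v s : In s L -> (forall t, In t L -> M s t = idop Y s t) ->
  apply d Y M v s = v s.
Proof.
  intros hs h. rewrite <- (csum_idop_l d Y s v ny hs).
  apply csum_ext; intros t ht. rewrite h; auto.
Qed.

Lemma inner_hermitian F v w : hermitian d Y F ->
  inner d Y (apply d Y F v) w = inner d Y v (apply d Y F w).
Proof.
  intros hF. unfold inner, apply.
  transitivity (csum L (fun s => csum L (fun u =>
    Cmul (Cconj (v u)) (Cmul (F u s) (w s))))).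
  - apply csum_ext; intros s hs. rewrite <- csum_conj, <- csum_mul_r.
    apply csum_ext; intros u hu. rewrite Cconj_mul, <- (hF u s) by assumption. ring.
  - rewrite csum_swap. apply csum_ext; intros u _. apply csum_mul_l.
Qed.

Lemma inner_conj v w : Cconj (inner d Y v w) = inner d Y w v.
Proof.
  unfold inner. rewrite <- csum_conj. apply csum_ext; intros s _.
  rewrite Cconj_mul, Cconj_invol. ring.
Qed.

Lemma inner_self v : inner d Y v v = RtoC (rsum L (fun s => Cmod (v s) ^ 2)).
Proof. rewrite <- csum_RtoC. apply csum_ext; intros s _. apply Cmul_conj. Qed.

Lemma vnorm_inner v w : inner d Y v v = inner d Y w w -> vnorm d Y v = vnorm d Y w.
Proof.
  rewrite !inner_self. intros e. apply RtoC_inj in e. unfold rsum in e. unfold vnorm. rewrite e. reflexivity.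
Qed.

Lemma involution_isometry F v : involution d Y F ->
  inner d Y (apply d Y F v) (apply d Y F v) = inner d Y v v.
Proof.
  intros [hF h2]. rewrite inner_hermitian by assumption. apply inner_ext; [auto|].
  intros s hs. rewrite <- apply_opmul. apply apply_idop; auto.
Qed.

(* Expanding [|v + s F v|^2 >= 0] for [s = 1, -1] avoids Cauchy-Schwarz. *)
Lemma involution_expectation F v : involution d Y F -> inner d Y v v = C1 ->
  snd (inner d Y v (apply d Y F v)) = 0 /\ Rabs (fst (inner d Y v (apply d Y F v))) <= 1.
Proof.
  intros hF hv.
  assert (real : snd (inner d Y v (apply d Y F v)) = 0).
  { apply Cconj_fixed_real. rewrite inner_conj. symmetry. apply inner_hermitian, hF. }
  split; [exact real|].
  assert (h : forall r, r * r = 1 ->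
    0 <= 2 + 2 * (r * fst (inner d Y v (apply d Y F v)))).
  { intros r hr. set (w := fun s => Cadd (v s) (Cmul (RtoC r) (apply d Y F v s))).
    assert (e : inner d Y w w = Cadd (Cadd (inner d Y v v)
       (Cmul (RtoC (r * r)) (inner d Y (apply d Y F v) (apply d Y F v))))
       (Cmul (RtoC r) (Cadd (inner d Y v (apply d Y F v)) (inner d Y (apply d Y F v) v)))).
    { unfold inner, w. rewrite <- csum_add, <- !csum_mul_l, <- !csum_add.
      apply csum_ext; intros s _.
      rewrite Cconj_add, Cconj_mul, Cconj_RtoC, RtoC_mul. ring. }
    rewrite involution_isometry, (inner_hermitian F v v), hv, hr in e by apply hF.
    pose proof (rsum_nonneg L (fun s => Cmod (w s) ^ 2) (fun s _ => pow2_ge_0 _)) as hw.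
    change (0 <= fst (RtoC (rsum L (fun s => Cmod (w s) ^ 2)))) in hw.
    rewrite <- inner_self, e in hw. simpl in hw. lra. }
  pose proof (h 1 ltac:(ring)). pose proof (h (-1) ltac:(ring)).
  apply Rabs_le. lra.
Qed.

Lemma specdec_trace_mul M U lam F : specdec d Y M U lam ->
  trace d Y (opmul d Y M F) =
  csum L (fun i => Cmul (RtoC (lam i))
    (inner d Y (fun s => U s i) (apply d Y F (fun s => U s i)))).
Proof.
  intros [hU hM]. unfold trace, opmul, inner, apply.
  transitivity (csum L (fun s => csum L (fun u => csum L (fun i =>
    Cmul (RtoC (lam i)) (Cmul (Cconj (U u i)) (Cmul (F u s) (U s i))))))).
  - apply csum_ext; intros s hs. apply csum_ext; intros u hu.
    rewrite hM by assumption. unfold diag_op. rewrite <- csum_mul_r.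
    apply csum_ext; intros i _. ring.
  - transitivity (csum L (fun s => csum L (fun i => csum L (fun u =>
      Cmul (RtoC (lam i)) (Cmul (Cconj (U u i)) (Cmul (F u s) (U s i))))))).
    { apply csum_ext; intros s _. apply csum_swap. }
    rewrite csum_swap. apply csum_ext; intros i _. rewrite csum_swap, <- csum_mul_l.
    apply csum_ext; intros u _. rewrite !csum_mul_l. reflexivity.
Qed.

(** Each eigenvector contributes its eigenvalue times a real expectation of [F] between -1 and 1.
    This is the Hölder inequality between trace norm and operator norm, for such [F]. *)
Lemma trace_mul_involution M U lam F : specdec d Y M U lam -> involution d Y F ->
  snd (trace d Y (opmul d Y M F)) = 0 /\
  Rabs (fst (trace d Y (opmul d Y M F))) <= rsum L (fun i => Rabs (lam i)).
Proof.
  intros hM hF. rewrite (specdec_trace_mul M U lam F hM).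
  assert (h : forall i, In i L -> inner d Y (fun s => U s i) (fun s => U s i) = C1).
  { intros i hi. unfold inner. rewrite (proj2 (proj1 hM)) by assumption. apply idop_eq. }
  split.
  - rewrite snd_csum.
    transitivity (rsum L (fun _ => 0 * 0)); [|rewrite rsum_mul_l; ring].
    apply rsum_ext; intros i hi. simpl.
    rewrite (proj1 (involution_expectation F _ hF (h i hi))). ring.
  - rewrite fst_csum. eapply Rle_trans; [apply rsum_abs|].
    apply rsum_le; intros i hi. simpl.
    rewrite Rmult_0_l, Rminus_0_r, Rabs_mult.
    pose proof (proj2 (involution_expectation F _ hF (h i hi))).
    pose proof (Rabs_pos (lam i)). nra.
Qed.

Lemma vnorm_component v s : In s L -> Cmod (v s) <= vnorm d Y v.
Proof.
  intros hs. unfold vnorm. rewrite <- (sqrt_pow2 (Cmod (v s))) by apply Cmod_nonneg.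
  apply sqrt_le_1_alt.
  apply (rsum_ge_term L s (fun s => Cmod (v s) ^ 2) hs). intros; apply pow2_ge_0.
Qed.

Lemma vnorm_zero : vnorm d Y (fun _ => C0) = 0.
Proof.
  unfold vnorm. transitivity (sqrt 0); [f_equal|apply sqrt_0]. change (rsum L (fun _ => Cmod C0 ^ 2) = 0).
  rewrite Cmod_sqr. simpl. transitivity (rsum L (fun _ => 0 * 0)).
  - apply rsum_ext; intros; simpl; ring.
  - rewrite rsum_mul_l; ring.
Qed.

(** [opnorm] is a chosen supremum, so nothing can be said about it before the set is known to be
    bounded and nonempty. *)
Lemma opnorm_lub M :
  is_lub (fun r => exists v, vnorm d Y v <= 1 /\ r = vnorm d Y (apply d Y M v)) (opnorm d Y M).
Proof.
  unfold opnorm, Rsup. apply epsilon_spec.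
  destruct (completeness (fun r => exists v, vnorm d Y v <= 1 /\ r = vnorm d Y (apply d Y M v)))
    as [m hm]; [| |exists m; exact hm].
  (* Any finite bound will do. The entries of a vector of norm at most 1 have modulus at most 1;
     bounding real and imaginary part of each product by [2 * Cmod (M s u)] avoids multiplicativity
     of [Cmod], and the outer factor 2 accounts for the two parts. *)
  - set (b := fun s => rsum L (fun u => 2 * Cmod (M s u))).
    exists (sqrt (rsum L (fun s => 2 * b s ^ 2))). intros r (v & hv & ->).
    unfold vnorm. apply sqrt_le_1_alt.
    change (rsum L (fun s => Cmod (apply d Y M v s) ^ 2) <= rsum L (fun s => 2 * b s ^ 2)).
    apply rsum_le; intros s _. rewrite Cmod_sqr. unfold apply. rewrite fst_csum, snd_csum.
    assert (hb : forall (z w : Cx), Cmod w <= 1 ->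
      Rabs (fst (Cmul z w)) <= 2 * Cmod z /\ Rabs (snd (Cmul z w)) <= 2 * Cmod z).
    { intros z w hw.
      (* Exchanging the coordinates keeps the modulus, so the bound on first components also serves
         for second ones. *)
      assert (hz1 := fst_le_Cmod z). assert (hz2 := fst_le_Cmod (snd z, fst z)).
      assert (hw1 := fst_le_Cmod w). assert (hw2 := fst_le_Cmod (snd w, fst w)).
      assert (sw : forall q : Cx, Cmod (snd q, fst q) = Cmod q)
        by (intros; unfold Cmod; simpl; f_equal; ring).
      rewrite sw in *. simpl in *.
      assert (hm : forall x y, Rabs x <= Cmod z -> Rabs y <= 1 -> Rabs (x * y) <= Cmod z).
      { intros x y hx hy. rewrite Rabs_mult. pose proof (Rabs_pos x). nra. }
      assert (w1 : Rabs (fst w) <= 1) by lra. assert (w2 : Rabs (snd w) <= 1) by lra.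
      split.
      - unfold Rminus. eapply Rle_trans; [apply Rabs_triang|]. rewrite Rabs_Ropp.
        pose proof (hm _ _ hz1 w1). pose proof (hm _ _ hz2 w2). lra.
      - eapply Rle_trans; [apply Rabs_triang|].
        pose proof (hm _ _ hz1 w2). pose proof (hm _ _ hz2 w1). lra. }
    assert (B : forall p : Cx -> R,
       (forall u, In u L -> Rabs (p (Cmul (M s u) (v u))) <= 2 * Cmod (M s u)) ->
       (rsum L (fun u => p (Cmul (M s u) (v u)))) ^ 2 <= b s ^ 2).
    { intros p hp. rewrite <- (pow2_abs (rsum _ _)). apply pow_incr. split; [apply Rabs_pos|].
      eapply Rle_trans; [apply rsum_abs|]. apply rsum_le. exact hp. }
    assert (hv' : forall u, In u L -> Cmod (v u) <= 1)
      by (intros u hu; eapply Rle_trans; [apply vnorm_component|]; eauto).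
    pose proof (B fst (fun u hu => proj1 (hb (M s u) (v u) (hv' u hu)))).
    pose proof (B snd (fun u hu => proj2 (hb (M s u) (v u) (hv' u hu)))).
    lra.
  - exists (vnorm d Y (apply d Y M (fun _ => C0))), (fun _ => C0). rewrite vnorm_zero.
    split; [lra|reflexivity].
Qed.

Lemma vnorm_nonneg v : 0 <= vnorm d Y v.
Proof. apply sqrt_pos. Qed.

Lemma opnorm_le M b :
  (forall v, vnorm d Y v <= 1 -> vnorm d Y (apply d Y M v) <= b) -> opnorm d Y M <= b.
Proof. intros h. apply (opnorm_lub M). intros r (v & hv & ->). auto. Qed.

Lemma opnorm_involution F : involution d Y F -> opnorm d Y F <= 1.
Proof.
  intros hF. apply opnorm_le; intros v hv.
  rewrite (vnorm_inner (apply d Y F v) v); [assumption|]. apply involution_isometry, hF.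
Qed.

Lemma opnorm_nonneg M : 0 <= opnorm d Y M.
Proof.
  eapply Rle_trans; [apply (vnorm_nonneg (apply d Y M (fun _ => C0)))|].
  apply (opnorm_lub M). exists (fun _ => C0). rewrite vnorm_zero. split; [lra|reflexivity].
Qed.

Lemma specdec_inner M U lam v : specdec d Y M U lam ->
  fst (inner d Y v (apply d Y M v)) =
  rsum L (fun i => lam i * Cmod (inner d Y (fun s => U s i) v) ^ 2).
Proof.
  intros [hU hM].
  assert (e : inner d Y v (apply d Y M v) = csum L (fun i =>
    RtoC (lam i * Cmod (inner d Y (fun s => U s i) v) ^ 2))).
  { transitivity (csum L (fun s => csum L (fun i => csum L (fun t =>
      Cmul (RtoC (lam i)) (Cmul (Cmul (Cconj (v s)) (U s i)) (Cmul (Cconj (U t i)) (v t))))))).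
    - apply csum_ext; intros s hs. unfold apply. rewrite <- csum_mul_l, csum_swap.
      apply csum_ext; intros t ht. rewrite hM by assumption. unfold diag_op.
      rewrite <- csum_mul_r, <- csum_mul_l. apply csum_ext; intros i _. ring.
    - rewrite csum_swap. apply csum_ext; intros i _.
      rewrite RtoC_mul, <- Cmul_conj, inner_conj. unfold inner.
      rewrite <- csum_prod, <- csum_mul_l. apply csum_ext; intros s _.
      rewrite csum_mul_l. reflexivity. }
  rewrite e, csum_RtoC. reflexivity.
Qed.

Lemma specdec_psd M U lam : specdec d Y M U lam -> (forall i, In i L -> 0 <= lam i) ->
  psd d Y M.
Proof.
  intros hM h. split; [eapply specdec_herm; eauto|]. intros v.
  rewrite (specdec_inner M U lam v hM). apply rsum_nonneg; intros i hi.
  apply Rmult_le_pos; [auto|apply pow2_ge_0].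
Qed.

Lemma psd_eigenvalue M U lam i : specdec d Y M U lam -> psd d Y M -> In i L -> 0 <= lam i.
Proof.
  intros hM [_ h] hi. specialize (h (fun s => U s i)).
  rewrite (specdec_inner M U lam _ hM) in h.
  assert (e : forall j, In j L ->
     inner d Y (fun s => U s j) (fun s => U s i) = idop Y j i)
    by (intros j hj; apply (proj2 (proj1 hM)); auto).
  assert (hz : RtoC (rsum L (fun j => lam j * Cmod (inner d Y (fun s => U s j) (fun s => U s i)) ^ 2))
               = RtoC (lam i)).
  { rewrite <- csum_RtoC, (csum_single L i).
    - rewrite e, idop_eq, RtoC_mul, <- Cmul_conj, Cconj_C1 by assumption. ring.
    - apply NoDup_confs; assumption.
    - assumption.
    - intros j hj ne. rewrite e, RtoC_mul, <- Cmul_conj, (idop_neq d) by auto. ring. }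
  apply RtoC_inj in hz. rewrite hz in h. exact h.
Qed.

(** Parseval: a unit vector of one basis is expanded in the other. Together with [overlap_sum_l],
    the squared overlaps form a doubly stochastic matrix. *)
Lemma overlap_sum_r U V i : unitary d Y U -> unitary d Y V -> In i L ->
  rsum L (fun j => Cmod (inner d Y (fun s => U s i) (fun s => V s j)) ^ 2) = 1.
Proof.
  intros hU hV hi. apply RtoC_inj. change (RtoC 1) with C1.
  rewrite <- csum_RtoC, <- (idop_eq Y i), <- (proj2 hU i i) by assumption.
  transitivity (csum L (fun j => csum L (fun s => csum L (fun t =>
    Cmul (Cmul (Cconj (U s i)) (U t i)) (Cmul (V s j) (Cconj (V t j))))))).
  - apply csum_ext; intros j _. rewrite <- Cmul_conj, inner_conj.
    rewrite (csum_swap L L). unfold inner.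
    rewrite <- csum_prod. apply csum_ext; intros t _. apply csum_ext; intros s _. ring.
  - rewrite csum_swap. apply csum_ext; intros s hs. rewrite csum_swap.
    rewrite <- (csum_idop_l d Y s (fun t => Cmul (Cconj (U s i)) (U t i))) by assumption.
    apply csum_ext; intros t ht. rewrite csum_mul_l, (proj1 hV) by assumption. ring.
Qed.

Lemma overlap_sum_l U V j : unitary d Y U -> unitary d Y V -> In j L ->
  rsum L (fun i => Cmod (inner d Y (fun s => U s i) (fun s => V s j)) ^ 2) = 1.
Proof.
  intros hU hV hj. rewrite <- (overlap_sum_r V U j hV hU hj).
  apply rsum_ext; intros i _. rewrite <- inner_conj. rewrite !Cmod_sqr. simpl. ring.
Qed.

Lemma specdec_apply_eigenvector M U lam i s : specdec d Y M U lam -> In i L -> In s L ->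
  apply d Y M (fun t => U t i) s = Cmul (RtoC (lam i)) (U s i).
Proof.
  intros [hU hM] hi hs. unfold apply.
  transitivity (csum L (fun t => csum L (fun j =>
    Cmul (Cmul (RtoC (lam j)) (U s j)) (Cmul (Cconj (U t j)) (U t i))))).
  - apply csum_ext; intros t ht. rewrite hM by assumption. unfold diag_op.
    rewrite <- csum_mul_r. apply csum_ext; intros j _. ring.
  - rewrite csum_swap.
    rewrite <- (csum_idop_r d Y i (fun j => Cmul (RtoC (lam j)) (U s j))) by assumption.
    apply csum_ext; intros j hj. rewrite csum_mul_l, (proj2 hU) by assumption. reflexivity.
Qed.

(* Uniqueness of the positive square root enters through the overlaps [<u_i, v_j>] of
   two eigenbases of [M^* M]: a nonzero overlap forces equal eigenvalues. *)
Lemma tnorm_specdec M U lam : specdec d Y M U lam ->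
  tnorm d Y M = rsum L (fun i => Rabs (lam i)).
Proof.
  intros hM. unfold tnorm.
  set (P := opmul d Y (adj M) M).
  assert (hP : specdec d Y P U (fun i => lam i * lam i)).
  { apply specdec_mul; [assumption| |assumption].
    apply (specdec_ext d Y M _ U lam); auto. intros s t hs ht. unfold adj.
    symmetry. apply (specdec_herm d Y M U lam); assumption. }
  destruct hM as [hU _].
  (* The choice in [opsqrt] is a positive root as soon as one exists; the witness has eigenvalues
     [Rabs (lam i)] in the eigenbasis of [M]. *)
  assert (hS : psd d Y (opsqrt d Y P) /\ forall s t, In s L -> In t L ->
    opmul d Y (opsqrt d Y P) (opsqrt d Y P) s t = P s t).
  { unfold opsqrt. apply epsilon_spec.
    set (S := diag_op d Y U (fun i => Rabs (lam i))).
    assert (hS : specdec d Y S U (fun i => Rabs (lam i))) by (split; auto).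
    exists S. split; [apply (specdec_psd S _ _ hS); intros; apply Rabs_pos|].
    intros s t hs ht. rewrite (proj2 (specdec_mul d Y ny _ _ _ _ _ hS hS)) by assumption.
    rewrite (proj2 hP) by assumption. apply csum_ext; intros i _. do 2 f_equal.
    rewrite <- Rabs_mult, Rabs_right; [reflexivity|nra]. }
  set (S := opsqrt d Y P) in *. destruct hS as [hpos hsq].
  destruct (spectral d Y S ny (proj1 hpos)) as (V & mu & hV).
  rewrite (specdec_trace d Y S V mu hV). simpl.
  set (o := fun i j => inner d Y (fun s => U s i) (fun s => V s j)).
  assert (key : forall i j, In i L -> In j L ->
    Rabs (lam i) * Cmod (o i j) ^ 2 = mu j * Cmod (o i j) ^ 2).
  { intros i j hi hj.
    (* Both sides are the matrix element of [P] between the two eigenvectors, with [P] acting to the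
       left or to the right. *)
    assert (e : Cmul (RtoC (lam i * lam i)) (o i j) = Cmul (RtoC (mu j * mu j)) (o i j)).
    { transitivity (inner d Y (apply d Y P (fun s => U s i)) (fun s => V s j)).
      - unfold o, inner. rewrite <- csum_mul_l. apply csum_ext; intros s hs.
        rewrite (specdec_apply_eigenvector P U _ i s hP) by assumption.
        rewrite Cconj_mul, Cconj_RtoC. ring.
      - rewrite inner_hermitian by (eapply specdec_herm; eauto).
        unfold o, inner. rewrite <- csum_mul_l. apply csum_ext; intros s hs.
        rewrite (specdec_apply_eigenvector P V (fun j => mu j * mu j) j s); auto.
        + ring.
        + apply (specdec_ext d Y (opmul d Y S S) _ V (fun j => mu j * mu j)); auto.
          * apply specdec_mul; assumption.
          * intros; symmetry; auto. }
    pose proof (psd_eigenvalue S V mu j hV hpos hj) as hmu.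
    destruct (Req_dec (lam i * lam i) (mu j * mu j)) as [e'|ne].
    - replace (Rabs (lam i)) with (mu j); [reflexivity|].
      apply Rsqr_inj; auto using Rabs_pos. unfold Rsqr.
      rewrite <- Rabs_mult, Rabs_right; nra.
    - rewrite Cmod_sqr. pose proof (f_equal fst e) as e1. pose proof (f_equal snd e) as e2.
      simpl in e1, e2. fold (o i j) in e1, e2.
      replace (fst (o i j)) with 0 by nra. replace (snd (o i j)) with 0 by nra. ring. }
  (* One double sum in two orders: over [i] first it gives the sum of the [mu j]; over [j] first,
     after [key], the sum of the [Rabs (lam i)]. *)
  transitivity (rsum L (fun j => rsum L (fun i => mu j * Cmod (o i j) ^ 2))).
  - apply rsum_ext; intros j hj. rewrite rsum_mul_l.
    unfold o. rewrite (overlap_sum_l U V j hU (proj1 hV) hj). ring.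
  - transitivity (rsum L (fun i => rsum L (fun j => mu j * Cmod (o i j) ^ 2))).
    + apply RtoC_inj. rewrite <- !csum_RtoC.
      transitivity (csum L (fun j => csum L (fun i => RtoC (mu j * Cmod (o i j) ^ 2)))).
      * apply csum_ext; intros j _. rewrite csum_RtoC. reflexivity.
      * rewrite csum_swap. apply csum_ext; intros i _. rewrite csum_RtoC. reflexivity.
    + apply rsum_ext; intros i hi.
      rewrite <- (Rmult_1_r (Rabs (lam i))).
      rewrite <- (overlap_sum_r U V i hU (proj1 hV) hi), <- rsum_mul_l.
      apply rsum_ext; intros j hj. symmetry. apply key; assumption.
Qed.

Lemma tnorm_nonneg M : hermitian d Y M -> 0 <= tnorm d Y M.
Proof.
  intros h. destruct (spectral d Y M ny h) as (U & lam & hM).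
  rewrite (tnorm_specdec M U lam hM). apply rsum_nonneg; intros; apply Rabs_pos.
Qed.

Lemma trace_mul_le_tnorm M F : hermitian d Y M -> involution d Y F ->
  Rabs (fst (trace d Y (opmul d Y M F))) <= tnorm d Y M.
Proof.
  intros h hF. destruct (spectral d Y M ny h) as (U & lam & hM).
  rewrite (tnorm_specdec M U lam hM). apply (trace_mul_involution M U lam F hM hF).
Qed.

(* [F] is the sign of [M]; being an involution, it stays one after tensoring with the
   identity, which is why the dual variable is taken of this form. *)
Lemma tnorm_dual M : hermitian d Y M ->
  exists F, involution d Y F /\ tnorm d Y M = fst (trace d Y (opmul d Y M F)).
Proof.
  intros h. destruct (spectral d Y M ny h) as (U & lam & hM).
  (* The eigenvalue 0 gets sign 1 rather than 0, so that [F] squares to the identity. *)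
  set (sg := fun i => if Rle_dec 0 (lam i) then 1 else -1).
  set (F := diag_op d Y U sg).
  assert (hF : specdec d Y F U sg) by (split; [apply hM|auto]).
  exists F. split; [split|].
  - eapply specdec_herm; eauto.
  - intros s t hs ht. rewrite (proj2 (specdec_mul d Y ny _ _ _ _ _ hF hF)) by assumption.
    rewrite (proj2 (specdec_idop d Y U (proj1 hM))) by assumption.
    apply csum_ext; intros i _. do 2 f_equal. unfold sg. destruct Rle_dec; ring.
  - rewrite (tnorm_specdec M U lam hM).
    rewrite (specdec_trace d Y _ U _ (specdec_mul d Y ny _ _ _ _ _ hM hF)). simpl.
    apply rsum_ext; intros i _. unfold sg.
    destruct Rle_dec; [rewrite Rabs_right|rewrite Rabs_left]; lra.
Qed.

End Norms.

(** * Tensor products *)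

Lemma opmul_assoc d Y M N P s t :
  opmul d Y (opmul d Y M N) P s t = opmul d Y M (opmul d Y N P) s t.
Proof.
  unfold opmul.
  transitivity (csum (confs d Y) (fun u => csum (confs d Y) (fun v =>
    Cmul (M s v) (Cmul (N v u) (P u t))))).
  - apply csum_ext; intros u _. rewrite <- csum_mul_r. apply csum_ext; intros v _. ring.
  - rewrite csum_swap. apply csum_ext; intros v _. apply csum_mul_l.
Qed.

Lemma opmul_ext d Y M M' N N' s t :
  (forall u, In u (confs d Y) -> M s u = M' s u) ->
  (forall u, In u (confs d Y) -> N u t = N' u t) ->
  opmul d Y M N s t = opmul d Y M' N' s t.
Proof. intros h h'. apply csum_ext; intros u hu. rewrite h, h'; auto. Qed.

Lemma trace_ext d Y M N : (forall s, In s (confs d Y) -> M s s = N s s) ->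
  trace d Y M = trace d Y N.
Proof. intros h. apply csum_ext; auto. Qed.

Lemma trace_cyclic d Y M N : trace d Y (opmul d Y M N) = trace d Y (opmul d Y N M).
Proof.
  unfold trace, opmul. rewrite csum_swap.
  apply csum_ext; intros s _. apply csum_ext; intros u _. ring.
Qed.

Lemma trace_opsub d Y M N : trace d Y (opsub M N) = Cadd (trace d Y M) (Copp (trace d Y N)).
Proof. unfold trace, opsub. rewrite csum_add, csum_opp. reflexivity. Qed.

Lemma opmul_opsub_l d Y M N F s t :
  opmul d Y (opsub M N) F s t = Cadd (opmul d Y M F s t) (Copp (opmul d Y N F s t)).
Proof.
  unfold opmul, opsub. rewrite <- csum_opp, <- csum_add.
  apply csum_ext; intros u _. ring.
Qed.

Lemma hermitian_opsub d Y M N : hermitian d Y M -> hermitian d Y N ->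
  hermitian d Y (opsub M N).
Proof.
  intros hM hN s t hs ht. unfold opsub.
  rewrite (hM s t), (hN s t), Cconj_add, Cconj_opp by assumption. reflexivity.
Qed.

Lemma hermitian_conjugation d Y M e : hermitian d Y M ->
  hermitian d Y (opmul d Y e (opmul d Y M (adj e))).
Proof.
  intros hM s t hs ht. unfold opmul, adj.
  transitivity (csum (confs d Y) (fun u => csum (confs d Y) (fun v =>
    Cmul (e s u) (Cmul (M u v) (Cconj (e t v)))))).
  - apply csum_ext; intros u _. rewrite <- csum_mul_l. reflexivity.
  - rewrite csum_swap, <- csum_conj. apply csum_ext; intros v hv.
    rewrite Cconj_mul, <- csum_conj, <- csum_mul_l. apply csum_ext; intros u hu.
    rewrite !Cconj_mul, Cconj_invol, (hM u v) by assumption. ring.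
Qed.

Lemma merge_cases2 d Y S T (P : Conf -> Conf -> Prop) : split_region Y S T ->
  (forall s t s' t', In s (confs d S) -> In t (confs d T) ->
     In s' (confs d S) -> In t' (confs d T) -> P (merge T s t) (merge T s' t')) ->
  forall a b, In a (confs d Y) -> In b (confs d Y) -> P a b.
Proof.
  intros hsp h a b ha hb. revert a ha. apply (merge_cases d Y S T _ hsp).
  intros s t hs ht. revert b hb. apply (merge_cases d Y S T _ hsp). auto.
Qed.

(** Holds since configurations vanish off their region. It makes [embed_merge] available for the
    factor on [T] too. *)
Lemma merge_comm d Y S T s t : split_region Y S T ->
  In s (confs d S) -> In t (confs d T) -> merge S t s = merge T s t.
Proof.
  intros (h1 & h2 & h3 & h4 & h5) hs ht.
  apply in_confs in hs as [_ hs], ht as [_ ht]; auto.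
  apply functional_extensionality; intros x. unfold merge.
  destruct (mem x S) eqn:e, (mem x T) eqn:e'; try reflexivity;
    rewrite <- ?Bool.not_true_iff_false, ?mem_In in *.
  - exfalso; eapply h5; eauto.
  - rewrite hs, ht; auto.
Qed.

Section Tensor.
Context (d : Site -> nat) (Y S T : list Site) (sp : split_region Y S T).

Lemma embed_hermitian h : hermitian d S h -> hermitian d Y (embed S Y h).
Proof.
  intros hh. unfold hermitian. apply (merge_cases2 d Y S T _ sp).
  intros s t s' t' hs ht hs' ht'. rewrite !(embed_merge d) by assumption.
  rewrite Cconj_mul, Cconj_idop, (hh s s'), (idop_sym T t t') by assumption. reflexivity.
Qed.

Lemma embed_opmul e e' a b : In a (confs d Y) -> In b (confs d Y) ->
  opmul d Y (embed S Y e) (embed S Y e') a b = embed S Y (opmul d S e e') a b.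
Proof.
  revert a b. apply (merge_cases2 d Y S T _ sp). intros s t s' t' hs ht hs' ht'.
  rewrite (embed_merge d) by assumption. unfold opmul.
  rewrite (csum_split d Y S T _ sp), <- csum_mul_r. apply csum_ext; intros u hu.
  rewrite <- (csum_idop_l d T t (fun v => Cmul (Cmul (e s u) (e' u s')) (idop T v t')))
    by (assumption || apply sp).
  apply csum_ext; intros v hv. rewrite !(embed_merge d) by assumption. ring.
Qed.

Lemma embed_idop M : (forall s s', In s (confs d S) -> In s' (confs d S) -> M s s' = idop S s s') ->
  forall a b, In a (confs d Y) -> In b (confs d Y) -> embed S Y M a b = idop Y a b.
Proof.
  intros h. apply (merge_cases2 d Y S T _ sp). intros s t s' t' hs ht hs' ht'.
  rewrite (embed_merge d), h, (idop_merge d Y S T) by assumption. reflexivity.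
Qed.

Lemma embed_involution f : involution d S f -> involution d Y (embed S Y f).
Proof.
  intros [h1 h2]. split; [apply embed_hermitian; assumption|].
  intros a b ha hb. rewrite embed_opmul by assumption. apply embed_idop; assumption.
Qed.

(** Tensoring with a fixed basis vector [z] of [T] is isometric and carries the action of [g] to
    that of its embedding. Belief propagation bounds a norm on the whole region, clustering asks for
    it on the ball, and this passes from one to the other. The second alternative covers a
    zero-dimensional space on [T], where no [z] exists. *)
Lemma opnorm_embed_ge g : opnorm d S g <= opnorm d Y (embed S Y g) \/ confs d T = [].
Proof.
  destruct (confs d T) as [|z l] eqn:eT; [right; reflexivity|left].
  assert (hz : In z (confs d T)) by (rewrite eT; left; reflexivity).
  assert (nS : NoDup S) by apply sp. assert (nT : NoDup T) by apply sp.
  assert (nY : NoDup Y) by apply sp.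
  set (ext := fun (v : Vec) c => Cmul (v (restrict S c)) (idop T (restrict T c) z)).
  assert (ext_merge : forall v s t, In s (confs d S) -> In t (confs d T) ->
    ext v (merge T s t) = Cmul (v s) (idop T t z)).
  { intros v s t hs ht. unfold ext.
    rewrite (restrict_merge_l d Y S T), (restrict_merge_r d T) by assumption. reflexivity. }
  assert (ext_norm : forall v, vnorm d Y (ext v) = vnorm d S v).
  { intros v.
    assert (e : inner d Y (ext v) (ext v) = inner d S v v).
    { unfold inner. rewrite (csum_split d Y S T _ sp). apply csum_ext; intros s hs.
      transitivity (csum (confs d T) (fun t =>
        Cmul (Cmul (Cmul (Cconj (v s)) (v s)) (idop T t z)) (idop T t z))).
      - apply csum_ext; intros t ht. rewrite ext_merge, Cconj_mul, Cconj_idop by assumption. ring.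
      - rewrite (csum_idop_r d T z) by assumption. rewrite idop_eq. ring. }
    rewrite !inner_self in e. apply RtoC_inj in e. unfold rsum in e.
    unfold vnorm. rewrite e. reflexivity. }
  assert (ext_apply : forall v c, In c (confs d Y) ->
    apply d Y (embed S Y g) (ext v) c = ext (apply d S g v) c).
  { intros v. apply (merge_cases d Y S T _ sp). intros s t hs ht.
    rewrite ext_merge by assumption. unfold apply. rewrite (csum_split d Y S T _ sp).
    rewrite <- csum_mul_r. apply csum_ext; intros s' hs'.
    rewrite <- (csum_idop_l d T t (fun t' => Cmul (Cmul (g s s') (v s')) (idop T t' z)))
      by assumption.
    apply csum_ext; intros t' ht'. rewrite ext_merge, (embed_merge d) by assumption. ring. }
  apply opnorm_le. intros v hv.
  apply (opnorm_lub d Y (embed S Y g)). exists (ext v). split; [rewrite ext_norm; assumption|].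
  rewrite <- ext_norm. apply vnorm_inner. apply inner_ext; intros c hc; symmetry;
    apply ext_apply; assumption.
Qed.

(** Partial trace and tensoring with the identity are dual to each other; this turns reduced states
    into expectations on the full region. *)
Lemma trace_ptrace M f :
  trace d S (opmul d S (ptrace d T M) f) = trace d Y (opmul d Y M (embed S Y f)).
Proof.
  unfold trace, opmul. rewrite (csum_split d Y S T _ sp). apply csum_ext; intros s hs.
  transitivity (csum (confs d S) (fun s' => csum (confs d T) (fun t =>
    Cmul (M (merge T s t) (merge T s' t)) (f s' s)))).
  { apply csum_ext; intros s' _. unfold ptrace. rewrite csum_mul_r. reflexivity. }
  rewrite csum_swap. apply csum_ext; intros t ht.
  rewrite (csum_split d Y S T _ sp). apply csum_ext; intros s' hs'.
  rewrite <- (csum_idop_r d T t (fun t' => Cmul (M (merge T s t) (merge T s' t')) (f s' s)))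
    by (assumption || apply sp).
  apply csum_ext; intros t' ht'. rewrite (embed_merge d) by assumption. ring.
Qed.

Lemma ptrace_hermitian M : hermitian d Y M -> hermitian d S (ptrace d T M).
Proof.
  intros hM s s' hs hs'. unfold ptrace. rewrite <- csum_conj. apply csum_ext; intros t ht.
  apply hM; apply (merge_confs d Y S T); assumption.
Qed.

(** Products of eigenvectors of [M1] and [M2] form an eigenbasis [W] of [M], and their eigenvalues
    add. Boltzmann weights and partition functions therefore multiply. *)
Lemma gibbs_factor beta M M1 M2 : hermitian d S M1 -> hermitian d T M2 ->
  confs d S <> [] -> confs d T <> [] ->
  (forall s t s' t', In s (confs d S) -> In t (confs d T) ->
     In s' (confs d S) -> In t' (confs d T) ->
     M (merge T s t) (merge T s' t') =
     Cadd (Cmul (M1 s s') (idop T t t')) (Cmul (idop S s s') (M2 t t'))) ->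
  forall s t s' t', In s (confs d S) -> In t (confs d T) ->
     In s' (confs d S) -> In t' (confs d T) ->
     gibbs d beta Y M (merge T s t) (merge T s' t') =
     Cmul (gibbs d beta S M1 s s') (gibbs d beta T M2 t t').
Proof.
  assert (nS : NoDup S) by apply sp. assert (nT : NoDup T) by apply sp.
  assert (nY : NoDup Y) by apply sp.
  intros h1 h2 neS neT hM.
  destruct (spectral d S M1 nS h1) as (U & lam & [[u1 u2] hU]).
  destruct (spectral d T M2 nT h2) as (V & mu & [[v1 v2] hV]).
  set (W := fun a i : Conf => Cmul (U (restrict S a) (restrict S i)) (V (restrict T a) (restrict T i))).
  set (nu := fun i : Conf => lam (restrict S i) + mu (restrict T i)).
  assert (W_merge : forall s t i j, In s (confs d S) -> In t (confs d T) ->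
    In i (confs d S) -> In j (confs d T) ->
    W (merge T s t) (merge T i j) = Cmul (U s i) (V t j)).
  { intros. unfold W. rewrite !(restrict_merge_l d Y S T), !(restrict_merge_r d T) by assumption.
    reflexivity. }
  assert (nu_merge : forall i j, In i (confs d S) -> In j (confs d T) ->
    nu (merge T i j) = lam i + mu j).
  { intros. unfold nu. rewrite (restrict_merge_l d Y S T), (restrict_merge_r d T) by assumption.
    reflexivity. }
  assert (hW : specdec d Y M W nu).
  { split; [split|].
    - apply (merge_cases2 d Y S T _ sp). intros s t s' t' hs ht hs' ht'.
      rewrite (idop_merge d Y S T), <- u1, <- v1, <- csum_prod by assumption.
      rewrite (csum_split d Y S T _ sp). apply csum_ext; intros i hi.
      apply csum_ext; intros j hj. rewrite !W_merge, Cconj_mul by assumption. ring.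
    - apply (merge_cases2 d Y S T _ sp). intros s t s' t' hs ht hs' ht'.
      rewrite (idop_merge d Y S T), <- u2, <- v2, <- csum_prod by assumption.
      rewrite (csum_split d Y S T _ sp). apply csum_ext; intros i hi.
      apply csum_ext; intros j hj. rewrite !W_merge, Cconj_mul by assumption. ring.
    - apply (merge_cases2 d Y S T _ sp). intros s t s' t' hs ht hs' ht'.
      rewrite hM, hU, hV, <- u1, <- v1 by assumption. unfold diag_op.
      rewrite <- !csum_prod, <- csum_add, (csum_split d Y S T _ sp).
      apply csum_ext; intros i hi. rewrite <- csum_add. apply csum_ext; intros j hj.
      rewrite !W_merge, nu_merge, Cconj_mul, RtoC_add by assumption. ring. }
  intros s t s' t' hs ht hs' ht'.
  rewrite (proj2 (specdec_gibbs d Y nY beta M W nu hW)) by (apply (merge_confs d Y S T); assumption).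
  rewrite (proj2 (specdec_gibbs d S nS beta M1 U lam (conj (conj u1 u2) hU))) by assumption.
  rewrite (proj2 (specdec_gibbs d T nT beta M2 V mu (conj (conj v1 v2) hV))) by assumption.
  assert (hZ : rsum (confs d Y) (fun j => exp (- beta * nu j)) =
    rsum (confs d S) (fun j => exp (- beta * lam j)) * rsum (confs d T) (fun j => exp (- beta * mu j))).
  { apply RtoC_inj. rewrite RtoC_mul, <- !csum_RtoC, <- csum_prod, (csum_split d Y S T _ sp).
    apply csum_ext; intros i hi. apply csum_ext; intros j hj.
    rewrite nu_merge, <- RtoC_mul, <- exp_plus by assumption. do 2 f_equal. ring. }
  unfold diag_op. rewrite <- csum_prod, (csum_split d Y S T _ sp).
  apply csum_ext; intros i hi. apply csum_ext; intros j hj.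
  rewrite !W_merge, Cconj_mul by assumption.
  assert (e : gibbs_weight d Y beta nu (merge T i j) =
    gibbs_weight d S beta lam i * gibbs_weight d T beta mu j).
  { unfold gibbs_weight. rewrite hZ, nu_merge by assumption.
    replace (- beta * (lam i + mu j)) with (- beta * lam i + - beta * mu j) by ring.
    rewrite exp_plus, Rinv_mult. ring. }
  rewrite e, RtoC_mul. ring.
Qed.

End Tensor.

(** * Embeddings from nested and from disjoint regions *)

Lemma embed_trans Y S T Z h : split_region Y S T -> NoDup Z -> incl Z S ->
  forall a b, embed Z Y h a b = embed S Y (embed Z S h) a b.
Proof.
  intros (h1 & h2 & h3 & h4 & h5) nZ hZ a b. unfold embed.
  assert (r : forall c, restrict Z (restrict S c) = restrict Z c).
  { intros c. apply functional_extensionality; intros x. unfold restrict.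
    destruct (mem x Z) eqn:e; [|reflexivity]. apply mem_In in e.
    rewrite (proj2 (mem_In x S) (hZ x e)). reflexivity. }
  rewrite !r.
  assert (e : conf_eqb (minus Y Z) a b =
    andb (conf_eqb (minus Y S) a b) (conf_eqb (minus S Z) (restrict S a) (restrict S b))).
  { apply Bool.eq_iff_eq_true. rewrite Bool.andb_true_iff, !conf_eqb_spec. unfold restrict.
    split.
    - intros h'. split; intros x hx; apply In_minus in hx as [hx1 hx2].
      + apply h', In_minus. split; [assumption|]. intros hz; apply hx2, hZ, hz.
      + rewrite (proj2 (mem_In x S) hx1). apply h', In_minus. split; [apply h4; auto|assumption].
    - intros [h' h''] x hx. apply In_minus in hx as [hx1 hx2].
      destruct (in_dec site_eq_dec x S) as [i|n].
      + specialize (h'' x (proj2 (In_minus x S Z) (conj i hx2))).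
        rewrite (proj2 (mem_In x S) i) in h''. assumption.
      + apply h', In_minus. auto. }
  rewrite e. destruct (conf_eqb (minus Y S) a b), (conf_eqb (minus S Z) _ _); reflexivity.
Qed.

(** Of all intermediate configurations only one contributes, equal to [t] on [A] and to [s]
    elsewhere. The resulting formula is symmetric in the two factors, which gives
    [embed_commute]. *)
Lemma embed_disjoint_mul d Y A B f g s t :
  NoDup Y -> incl A Y -> incl B Y -> (forall x, In x A -> ~ In x B) ->
  In s (confs d Y) -> In t (confs d Y) ->
  opmul d Y (embed A Y f) (embed B Y g) s t =
  if conf_eqb (minus Y (A ++ B)) s t
  then Cmul (f (restrict A s) (restrict A t)) (g (restrict B s) (restrict B t)) else C0.
Proof.
  intros nY hA hB dis hs ht. set (u := merge A s t).
  assert (hu : In u (confs d Y)).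
  { apply in_confs in hs as [s1 s2], ht as [t1 t2]; auto. apply in_confs; [assumption|].
    unfold u, merge. split; intros x hx; destruct (mem x A); auto. }
  unfold opmul. rewrite (csum_single _ u); auto using NoDup_confs.
  - unfold embed, u.
    assert (e1 : conf_eqb (minus Y A) s (merge A s t) = true).
    { apply conf_eqb_spec; intros x hx. apply In_minus in hx as [_ hx]. unfold merge.
      destruct (mem x A) eqn:e; [apply mem_In in e; contradiction|reflexivity]. }
    assert (e2 : conf_eqb (minus Y B) (merge A s t) t = conf_eqb (minus Y (A ++ B)) s t).
    { apply Bool.eq_iff_eq_true. rewrite !conf_eqb_spec. unfold merge.
      split; intros h x hx; apply In_minus in hx as [hx1 hx2].
      - rewrite in_app_iff in hx2.
        assert (hB' : ~ In x B) by tauto.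
        specialize (h x (proj2 (In_minus x Y B) (conj hx1 hB'))).
        destruct (mem x A) eqn:e; [apply mem_In in e; tauto|assumption].
      - destruct (mem x A) eqn:e; [reflexivity|].
        rewrite <- Bool.not_true_iff_false, mem_In in e.
        apply h, In_minus. rewrite in_app_iff. tauto. }
    assert (e3 : restrict A (merge A s t) = restrict A t).
    { apply functional_extensionality; intros x. unfold restrict, merge.
      destruct (mem x A); reflexivity. }
    assert (e4 : restrict B (merge A s t) = restrict B s).
    { apply functional_extensionality; intros x. unfold restrict, merge.
      destruct (mem x B) eqn:e; [|reflexivity]. destruct (mem x A) eqn:e'; [|reflexivity].
      rewrite mem_In in *. exfalso; eapply dis; eauto. }
    rewrite e1, e2, e3, e4. destruct (conf_eqb _ s t); ring.
  - intros v hv ne. unfold embed.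
    destruct (conf_eqb (minus Y A) s v) eqn:e1; [|ring].
    destruct (conf_eqb (minus Y B) v t) eqn:e2; [|ring].
    exfalso; apply ne. apply (conf_ext d Y); auto. intros x hx.
    rewrite conf_eqb_spec in e1, e2. unfold u, merge. destruct (mem x A) eqn:e.
    + apply mem_In in e. apply e2, In_minus. split; [assumption|]. apply dis, e.
    + rewrite <- Bool.not_true_iff_false, mem_In in e. symmetry. apply e1, In_minus. auto.
Qed.

Lemma embed_commute d Y A B f g s t :
  NoDup Y -> incl A Y -> incl B Y -> (forall x, In x A -> ~ In x B) ->
  In s (confs d Y) -> In t (confs d Y) ->
  opmul d Y (embed A Y f) (embed B Y g) s t = opmul d Y (embed B Y g) (embed A Y f) s t.
Proof.
  intros nY hA hB dis hs ht.
  rewrite !embed_disjoint_mul; auto; [|intros x hb ha; exact (dis x ha hb)].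
  assert (e : conf_eqb (minus Y (A ++ B)) s t = conf_eqb (minus Y (B ++ A)) s t).
  { apply Bool.eq_iff_eq_true. rewrite !conf_eqb_spec.
    split; intros h x hx; apply h; rewrite In_minus, in_app_iff in *; tauto. }
  rewrite e. destruct (conf_eqb (minus Y (B ++ A)) s t); ring.
Qed.

Lemma embed_adj Z Y e s t : adj (embed Z Y e) s t = embed Z Y (adj e) s t.
Proof.
  unfold adj, embed.
  assert (h : conf_eqb (minus Y Z) t s = conf_eqb (minus Y Z) s t).
  { apply Bool.eq_iff_eq_true. rewrite !conf_eqb_spec. split; intros h x hx; symmetry; auto. }
  rewrite h. destruct (conf_eqb _ s t); [reflexivity|apply Cconj_C0].
Qed.

(** * Euclidean distance *)

Lemma sdist_sym x y : sdist x y = sdist y x.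
Proof.
  unfold sdist. f_equal. revert y.
  induction x as [|a x IH]; intros [|b y]; auto.
  cbn [combine map fold_right fst snd].
  rewrite IH, !minus_IZR. ring.
Qed.

Lemma sdist_refl x : sdist x x = 0.
Proof.
  unfold sdist. transitivity (sqrt 0); [f_equal|apply sqrt_0].
  induction x as [|a x IH]; [reflexivity|]. cbn [combine map fold_right fst snd].
  rewrite IH, Z.sub_diag. ring.
Qed.

Lemma Minkowski_plane x y u w :
  sqrt ((x + y) ^ 2 + (u + w) ^ 2) <= sqrt (x ^ 2 + u ^ 2) + sqrt (y ^ 2 + w ^ 2).
Proof.
  set (P := sqrt (x ^ 2 + u ^ 2)). set (Q := sqrt (y ^ 2 + w ^ 2)).
  assert (hP : 0 <= P) by apply sqrt_pos. assert (hQ : 0 <= Q) by apply sqrt_pos.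
  assert (eP : P ^ 2 = x ^ 2 + u ^ 2) by (apply pow2_sqrt; nra).
  assert (eQ : Q ^ 2 = y ^ 2 + w ^ 2) by (apply pow2_sqrt; nra).
  rewrite <- (sqrt_pow2 (P + Q)) by lra. apply sqrt_le_1_alt.
  assert (h : x * y + u * w <= P * Q).
  { apply Rsqr_incr_0_var; [|nra]. unfold Rsqr.
    replace (P * Q * (P * Q)) with (P ^ 2 * Q ^ 2) by ring. rewrite eP, eQ.
    (* Cauchy-Schwarz in the plane, from Lagrange's identity. *)
    pose proof (pow2_ge_0 (x * w - u * y)). nra. }
  nra.
Qed.

(** A Euclidean norm is the planar norm of the first coordinate and the norm of the tail, so
    induction on the dimension needs only [Minkowski_plane]. Equal lengths matter because [combine]
    truncates. *)
Lemma sdist_triangle n x y z : length x = n -> length y = n -> length z = n ->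
  sdist x z <= sdist x y + sdist y z.
Proof.
  unfold sdist. revert x y z. induction n as [|n IH]; intros x y z hx hy hz.
  - destruct x, y, z; try discriminate. simpl. rewrite sqrt_0. lra.
  - destruct x as [|a x], y as [|b y], z as [|c z]; try discriminate.
    injection hx as hx. injection hy as hy. injection hz as hz.
    specialize (IH x y z hx hy hz). cbn [combine map fold_right fst snd].
    assert (pos : forall l : list (Z * Z),
      0 <= fold_right Rplus 0 (map (fun p => IZR (fst p - snd p) ^ 2) l)).
    { induction l as [|p l IHl]; cbn [map fold_right]; [lra|].
      pose proof (pow2_ge_0 (IZR (fst p - snd p))). lra. }
    revert IH. generalize (pos (combine x y)) (pos (combine y z)) (pos (combine x z)).
    generalize (fold_right Rplus 0 (map (fun p => IZR (fst p - snd p) ^ 2) (combine x y))).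
    generalize (fold_right Rplus 0 (map (fun p => IZR (fst p - snd p) ^ 2) (combine y z))).
    generalize (fold_right Rplus 0 (map (fun p => IZR (fst p - snd p) ^ 2) (combine x z))).
    intros r q p hp hq hr h.
    pose proof (Minkowski_plane (IZR (a - b)) (IZR (b - c)) (sqrt p) (sqrt q)) as hm.
    rewrite (pow2_sqrt p hp), (pow2_sqrt q hq) in hm.
    eapply Rle_trans; [|exact hm]. apply sqrt_le_1_alt.
    replace (IZR (a - b) + IZR (b - c)) with (IZR (a - c)) by (rewrite !minus_IZR; ring).
    pose proof (sqrt_pos r). pose proof (pow2_sqrt r hr). nra.
Qed.

(** * Local Hamiltonians *)

Lemma subl_incl Z Y : subl Z Y = true <-> incl Z Y.
Proof.
  unfold subl. rewrite forallb_forall. unfold incl.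
  split; intros h x hx; [apply mem_In|apply mem_In]; auto.
Qed.

(** With the filter turned into a condition inside a sum over all of [H], Hamiltonians of different
    regions can be compared term by term. *)
Lemma HYon_entry H S W s t : HYon H S W s t =
  csum H (fun p => if subl (fst p) S then embed (fst p) W (snd p) s t else C0).
Proof.
  unfold HYon. induction H as [|p H IH]; simpl; [reflexivity|].
  destruct (subl (fst p) S); simpl; [unfold opadd; rewrite IH; reflexivity|].
  rewrite IH. ring.
Qed.

Definition hermitian_terms (d : Site -> nat) (H : Ham) : Prop :=
  forall Z h, In (Z, h) H -> NoDup Z /\ hermitian d Z h.

Lemma HYon_embed d H Y S T a b : hermitian_terms d H -> split_region Y S T ->
  HYon H S Y a b = embed S Y (HY H S) a b.
Proof.
  intros hH sp. rewrite HYon_entry. unfold embed at 2. unfold HY.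
  rewrite HYon_entry.
  transitivity (csum H (fun p => if subl (fst p) S
    then embed S Y (embed (fst p) S (snd p)) a b else C0)).
  - apply csum_ext; intros [Z h] hp. cbn [fst snd]. destruct (subl Z S) eqn:e; [|reflexivity].
    apply embed_trans with T; [assumption|apply (hH Z h hp)|apply subl_incl, e].
  - unfold embed at 1. destruct (conf_eqb (minus Y S) a b); [reflexivity|].
    apply csum_zero; intros p _. destruct (subl (fst p) S); reflexivity.
Qed.

Lemma HY_hermitian d H Y : hermitian_terms d H -> NoDup Y -> hermitian d Y (HY H Y).
Proof.
  intros hH nY s t hs ht. unfold HY. rewrite !HYon_entry, <- csum_conj.
  apply csum_ext; intros [Z h] hp. cbn [fst snd]. destruct (subl Z Y) eqn:e; [|symmetry; apply Cconj_C0].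
  apply subl_incl in e. destruct (hH Z h hp) as [nZ hZ].
  apply (embed_hermitian d Y Z (minus Y Z)); auto using split_minus.
Qed.

Lemma HY_decouple d H Y S T a b : hermitian_terms d H -> split_region Y S T ->
  (forall Z h, In (Z, h) H -> Z <> [] /\ (incl Z Y -> incl Z S \/ incl Z T)) ->
  HY H Y a b = Cadd (embed S Y (HY H S) a b) (embed T Y (HY H T) a b).
Proof.
  intros hH sp dec.
  rewrite <- (HYon_embed d H Y S T a b), <- (HYon_embed d H Y T S a b)
    by (assumption || apply split_sym; assumption).
  unfold HY. rewrite !HYon_entry, <- csum_add. apply csum_ext; intros [Z h] hp. cbn [fst snd].
  destruct (dec Z h hp) as [ne dec'].
  (* A term with empty support would be counted on both sides. *)
  assert (dis : incl Z S -> incl Z T -> False).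
  { intros h1 h2. destruct Z as [|z Z]; [congruence|]. destruct sp as (_ & _ & _ & _ & sp).
    apply (sp z); [apply h1|apply h2]; left; reflexivity. }
  assert (sub : incl Z S \/ incl Z T -> incl Z Y).
  { destruct sp as (_ & _ & _ & sp & _). intros [h'|h'] x hx; apply sp; auto. }
  rewrite <- !subl_incl in *.
  destruct (subl Z Y), (subl Z S), (subl Z T); try ring; exfalso; intuition discriminate.
Qed.

(** * Gibbs states *)

Section Gibbs.
Context (d : Site -> nat) (beta : R) (hd : forall x, (1 <= d x)%nat).

Lemma confs_nonempty Y : NoDup Y -> confs d Y <> [].
Proof.
  intros nY e. assert (h : In (fun _ => 0%nat) (confs d Y)).
  { apply in_confs; [assumption|]. split; [intros x _; apply hd|reflexivity]. }
  rewrite e in h. exact h.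
Qed.

Lemma gibbs_hermitian Y M : NoDup Y -> hermitian d Y M -> hermitian d Y (gibbs d beta Y M).
Proof.
  intros nY hM. destruct (spectral d Y M nY hM) as (U & lam & h).
  eapply specdec_herm, specdec_gibbs; eauto.
Qed.

Lemma gibbs_trace Y M : NoDup Y -> hermitian d Y M -> trace d Y (gibbs d beta Y M) = C1.
Proof.
  intros nY hM. destruct (spectral d Y M nY hM) as (U & lam & h).
  rewrite (specdec_trace d Y _ U _ (specdec_gibbs d Y nY beta M U lam h)).
  rewrite gibbs_weight_sum by (apply confs_nonempty; assumption). reflexivity.
Qed.

Lemma gibbs_expectation_bound Y M F : NoDup Y -> hermitian d Y M -> involution d Y F ->
  snd (trace d Y (opmul d Y (gibbs d beta Y M) F)) = 0 /\
  Rabs (fst (trace d Y (opmul d Y (gibbs d beta Y M) F))) <= 1.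
Proof.
  intros nY hM hF. destruct (spectral d Y M nY hM) as (U & lam & h).
  destruct (trace_mul_involution d Y nY _ _ _ F (specdec_gibbs d Y nY beta M U lam h) hF) as [h1 h2].
  split; [assumption|]. eapply Rle_trans; [exact h2|].
  rewrite <- (gibbs_weight_sum d Y (confs_nonempty Y nY) beta lam). right.
  apply rsum_ext; intros i _. apply Rabs_right.
  pose proof (gibbs_weight_pos d Y (confs_nonempty Y nY) beta lam i). lra.
Qed.

(** The state on [T] has trace 1 and drops out. Used with [T] a single removed site, and with [T]
    the part of [C] cut off by its boundary. *)
Lemma gibbs_marginal Y S T M M1 M2 A f : split_region Y S T ->
  hermitian d S M1 -> hermitian d T M2 ->
  (forall a b, In a (confs d Y) -> In b (confs d Y) ->
     M a b = Cadd (embed S Y M1 a b) (embed T Y M2 a b)) ->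
  NoDup A -> incl A S ->
  trace d Y (opmul d Y (gibbs d beta Y M) (embed A Y f)) =
  trace d S (opmul d S (gibbs d beta S M1) (embed A S f)).
Proof.
  intros sp h1 h2 hM nA hA.
  assert (nS : NoDup S) by apply sp. assert (nT : NoDup T) by apply sp.
  transitivity (trace d Y (opmul d Y (gibbs d beta Y M) (embed S Y (embed A S f)))).
  { apply trace_ext; intros a ha. apply opmul_ext; [reflexivity|].
    intros b hb. apply embed_trans with T; assumption. }
  rewrite <- (trace_ptrace d Y S T sp). apply trace_ext; intros s hs.
  apply opmul_ext; [|reflexivity]. intros s' hs'. unfold ptrace.
  transitivity (csum (confs d T) (fun t =>
    Cmul (gibbs d beta S M1 s s') (gibbs d beta T M2 t t))).
  - apply csum_ext; intros t ht.
    apply (gibbs_factor d Y S T sp); auto using confs_nonempty.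
    clear s t s' hs ht hs'. intros s t s' t' hs ht hs' ht'.
    rewrite hM by (apply (merge_confs d Y S T); assumption).
    rewrite (embed_merge d Y S T) by assumption.
    rewrite <- (merge_comm d Y S T s t), <- (merge_comm d Y S T s' t') by assumption.
    rewrite (embed_merge d Y T S) by (assumption || apply split_sym; assumption). ring.
  - rewrite csum_mul_l. change (Cmul (gibbs d beta S M1 s s') (trace d T (gibbs d beta T M2)) = gibbs d beta S M1 s s').
    rewrite gibbs_trace by assumption. ring.
Qed.

End Gibbs.

Lemma idop_involution d Y : NoDup Y -> involution d Y (idop Y).
Proof.
  intros nY. split.
  - intros s t _ _. rewrite Cconj_idop. apply idop_sym.
  - intros s t hs ht. apply (csum_idop_l d Y s (fun u => idop Y u t)); assumption.
Qed.

Lemma opnorm_ext_le d Y M N :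
  (forall s t, In s (confs d Y) -> In t (confs d Y) -> M s t = N s t) ->
  opnorm d Y M <= opnorm d Y N.
Proof.
  intros h. apply opnorm_le; intros v hv.
  apply (opnorm_lub d Y N). exists v. split; [assumption|].
  apply vnorm_inner. apply inner_ext; intros s hs; apply csum_ext; intros t ht; rewrite h; auto.
Qed.

(* The empty region has the one-dimensional Hilbert space, whose identity has
   positive norm. *)
Lemma clustering_nonneg Lam d H beta eps l :
  uniformly_clustering Lam d H beta eps -> 0 < l -> 0 <= eps l.
Proof.
  intros hc hl.
  assert (inv := idop_involution d [] (NoDup_nil Site)).
  assert (h := hc [] [] [] l (idop []) (idop []) (conj (NoDup_nil _) (incl_nil_l _))
    (NoDup_nil _) (NoDup_nil _) (incl_nil_l _) (incl_nil_l _) hl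
    (fun a b ha => match ha with end) (proj1 inv) (proj1 inv)).
  pose proof (Cmod_nonneg (Cadd (trace d [] (opmul d [] (gibbs d beta [] (HY H [])) (opmul d [] (embed [] [] (idop [])) (embed [] [] (idop [])))))
    (Copp (Cmul (trace d [] (opmul d [] (gibbs d beta [] (HY H [])) (embed [] [] (idop []))))
                (trace d [] (opmul d [] (gibbs d beta [] (HY H [])) (embed [] [] (idop [])))))))) as h0.
  unfold cov in h.
  assert (n1 : vnorm d [] (fun _ => C1) = 1).
  { change (sqrt (Cmod C1 ^ 2 + 0) = 1). rewrite Cmod_sqr. unfold C1; cbn [fst snd].
    replace (1 ^ 2 + 0 ^ 2 + 0) with 1 by ring. apply sqrt_1. }
  assert (hn : 1 <= opnorm d [] (idop [])).
  { rewrite <- n1 at 1. apply (opnorm_lub d [] (idop [])). exists (fun _ => C1).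
    split; [lra|]. symmetry. apply vnorm_inner, involution_isometry; [constructor|exact inv]. }
  destruct (Rle_or_lt 0 (eps l)) as [p|p]; [assumption|].
  assert (0 < opnorm d [] (idop []) * opnorm d [] (idop [])) by nra. nra.
Qed.

(** * Removing boundary sites one at a time *)

(** The quantity followed through the removals: a real number, whatever the region [Y]. *)
Definition local_expectation d H beta A f Y : R :=
  fst (trace d Y (opmul d Y (gibbs d beta Y (HY H Y)) (embed A Y f))).

(** Cyclicity brings [eta] to the right of [F], and [F] then passes through the adjoint of [eta]. It
    is applied both to the observable and to the identity. *)
Lemma trace_conjugation d Y rho eta F G : NoDup Y ->
  (forall s t, In s (confs d Y) -> In t (confs d Y) ->
     opmul d Y (adj eta) F s t = opmul d Y F (adj eta) s t) ->
  (forall s t, In s (confs d Y) -> In t (confs d Y) ->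
     opmul d Y (adj eta) eta s t = G s t) ->
  trace d Y (opmul d Y (opmul d Y eta (opmul d Y rho (adj eta))) F) =
  trace d Y (opmul d Y rho (opmul d Y F G)).
Proof.
  intros nY hc hG.
  transitivity (trace d Y (opmul d Y eta (opmul d Y (opmul d Y rho (adj eta)) F))).
  { apply trace_ext; intros s hs. apply opmul_assoc. }
  rewrite trace_cyclic. apply trace_ext; intros s hs.
  transitivity (opmul d Y (opmul d Y rho (adj eta)) (opmul d Y F eta) s s); [apply opmul_assoc|].
  transitivity (opmul d Y rho (opmul d Y (adj eta) (opmul d Y F eta)) s s); [apply opmul_assoc|].
  apply opmul_ext; [reflexivity|]. intros u hu.
  transitivity (opmul d Y (opmul d Y (adj eta) F) eta u s); [symmetry; apply opmul_assoc|].
  transitivity (opmul d Y (opmul d Y F (adj eta)) eta u s).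
  { apply opmul_ext; [|reflexivity]. intros v hv. apply hc; assumption. }
  transitivity (opmul d Y F (opmul d Y (adj eta) eta) u s); [apply opmul_assoc|].
  apply opmul_ext; [reflexivity|]. intros v hv. apply hG; assumption.
Qed.

Lemma trace_idop_r d Y M : NoDup Y -> trace d Y (opmul d Y M (idop Y)) = trace d Y M.
Proof.
  intros nY. apply trace_ext; intros s hs.
  apply (csum_idop_r d Y s (fun u => M s u)); assumption.
Qed.

Lemma split_remove1 Y y : NoDup Y -> In y Y -> split_region Y (remove1 Y y) [y].
Proof.
  intros nY hy. apply split_sym, split_minus; [assumption| |].
  - constructor; [simpl; tauto|constructor].
  - intros x [<-|[]]; assumption.
Qed.

Section Removal.
Context (D : nat) (Lam : list Site) (d : Site -> nat) (H : Ham) (beta c1 c2 ceta : R)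
  (eps : R -> R).
Hypothesis dim : forall x, In x Lam -> length x = D.
Hypothesis hd : forall x, (1 <= d x)%nat.
Hypothesis hH : hermitian_terms d H.
Hypothesis clust : uniformly_clustering Lam d H beta eps.
Hypothesis bp : belief_propagation Lam d H beta c1 c2 ceta.

Lemma removed_hermitian Y y : NoDup Y -> In y Y -> hermitian d Y (HYon H (remove1 Y y) Y).
Proof.
  intros nY hy s t hs ht.
  rewrite !(HYon_embed d H Y (remove1 Y y) [y]) by (auto using split_remove1).
  apply (embed_hermitian d Y (remove1 Y y) [y]); auto using split_remove1.
  apply HY_hermitian; [assumption|]. apply NoDup_filter; assumption.
Qed.

(** No sign is assumed for [c1]; it is inherited from the trace norm that this quantity bounds, once
    there is a site to remove. *)
Lemma gamma_nonneg Y y l : region Lam Y -> In y Y -> 0 <= l -> 0 <= c1 * exp (- c2 * l).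
Proof.
  intros hY hy hl. destruct (bp Y y l hY hy hl) as (e & _ & h).
  eapply Rle_trans; [|exact h]. apply tnorm_nonneg; [apply hY|].
  apply hermitian_opsub.
  - apply gibbs_hermitian; [apply hY|]. apply removed_hermitian; [apply hY|assumption].
  - apply hermitian_conjugation, gibbs_hermitian; [apply hY|].
    apply HY_hermitian; [assumption|apply hY].
Qed.

(** With the names of the end of the proof, p is close to r, r to a q, and a q to a. The first and
    last errors are gamma, the last because |a| is at most 1; this is the factor 2. The middle one
    is clustering for [f] and [g], whose norms are at most 1 and [ceta]. *)
Lemma remove_site Y y A f l : region Lam Y -> In y Y -> NoDup A -> incl A Y ->
  involution d A f -> 0 < l -> (forall a, In a A -> l <= sdist a y) ->
  Rabs (local_expectation d H beta A f (remove1 Y y) - local_expectation d H beta A f Y)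
    <= ceta * eps (l / 2) + 2 * (c1 * exp (- c2 * (l / 2))).
Proof.
  intros hY hy nA hA hf hl far. assert (hY' := hY). destruct hY' as [nY inY].
  assert (hl2 : 0 < l / 2) by lra.
  destruct (bp Y y (l / 2) hY hy ltac:(lra)) as (e & hceta & hbp).
  set (b := ball Y y (l / 2)) in *.
  assert (nb : NoDup b) by (apply NoDup_filter; assumption).
  assert (hb : forall x, In x b -> In x Y /\ sdist x y <= l / 2).
  { intros x hx. apply filter_In in hx as [h1 h2]. split; [assumption|].
    destruct (Rle_dec (sdist x y) (l / 2)); [assumption|discriminate]. }
  assert (ib : incl b Y) by (intros x hx; apply hb, hx).
  assert (dist : forall a x, In a A -> In x b -> l / 2 <= sdist a x).
  { intros a x ha hx. destruct (hb x hx) as [hx1 hx2]. specialize (far a ha).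
    pose proof (sdist_triangle D a x y (dim _ (inY _ (hA _ ha))) (dim _ (inY _ hx1))
      (dim _ (inY _ hy))). lra. }
  assert (dis : forall x, In x A -> ~ In x b).
  { intros x ha hx. specialize (far x ha). destruct (hb x hx) as [_ h]. lra. }
  set (rho := gibbs d beta Y (HY H Y)) in *.
  set (rho' := gibbs d beta Y (HYon H (remove1 Y y) Y)) in *.
  set (eta := embed b Y e) in *.
  set (F := embed A Y f).
  set (g := opmul d b (adj e) e).
  set (G := embed b Y g).
  assert (spA := split_minus Y A nY nA hA).
  assert (spb := split_minus Y b nY nb ib).
  assert (hF : involution d Y F) by (apply (embed_involution d Y A _ spA); assumption).
  assert (hHY : hermitian d Y (HY H Y)) by (apply HY_hermitian; assumption).
  assert (adj_eta : forall s t, adj eta s t = embed b Y (adj e) s t)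
    by (intros; apply embed_adj).
  assert (hG : forall s t, In s (confs d Y) -> In t (confs d Y) ->
    opmul d Y (adj eta) eta s t = G s t).
  { intros s t hs ht. unfold G, g. rewrite <- (embed_opmul d Y b _ spb) by assumption.
    apply opmul_ext; [|reflexivity]. intros; apply adj_eta. }
  assert (hcomm : forall s t, In s (confs d Y) -> In t (confs d Y) ->
     opmul d Y (adj eta) F s t = opmul d Y F (adj eta) s t).
  { intros s t hs ht.
    transitivity (opmul d Y (embed b Y (adj e)) F s t);
      [apply opmul_ext; [intros; apply adj_eta|reflexivity]|].
    transitivity (opmul d Y F (embed b Y (adj e)) s t);
      [|apply opmul_ext; [reflexivity|intros; symmetry; apply adj_eta]].
    symmetry. apply embed_commute; assumption. }
  assert (hg : hermitian d b g).
  { intros s t hs ht. unfold g, opmul, adj. rewrite <- csum_conj.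
    apply csum_ext; intros u _. rewrite Cconj_mul, Cconj_invol. ring. }
  assert (ng : opnorm d b g <= ceta).
  { destruct (opnorm_embed_ge d Y b _ spb g) as [h|h].
    - eapply Rle_trans; [exact h|]. eapply Rle_trans; [|exact hceta].
      apply opnorm_ext_le. intros s t hs ht. symmetry. apply hG; assumption.
    - exfalso; revert h. apply confs_nonempty; [assumption|apply spb]. }
  assert (nf : opnorm d A f <= 1) by (apply opnorm_involution; assumption).
  assert (heps : 0 <= eps (l / 2)) by (eapply clustering_nonneg; eauto).
  assert (hcov := clust Y A b (l / 2) f g hY nA nb hA ib hl2 dist (proj1 hf) hg).
  assert (bound : opnorm d A f * opnorm d b g * eps (l / 2) <= ceta * eps (l / 2)).
  { pose proof (opnorm_nonneg d A f). pose proof (opnorm_nonneg d b g).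
    apply Rmult_le_compat_r; [assumption|]. nra. }
  fold rho F G in hcov. unfold cov in hcov.
  destruct (gibbs_expectation_bound d beta hd Y _ F nY hHY hF) as [im_a abs_a].
  fold rho in im_a, abs_a.
  pose proof (fst_le_Cmod (Cadd (trace d Y (opmul d Y rho (opmul d Y F G)))
    (Copp (Cmul (trace d Y (opmul d Y rho F)) (trace d Y (opmul d Y rho G)))))) as hre.
  assert (herm : hermitian d Y (opsub rho' (opmul d Y eta (opmul d Y rho (adj eta))))).
  { apply hermitian_opsub.
    - apply gibbs_hermitian; auto using removed_hermitian.
    - apply hermitian_conjugation, gibbs_hermitian; assumption. }
  (* Needed for [F], and for the identity, where it says that tr(rho G) is close to 1. *)
  assert (sub : forall P, involution d Y P ->
    Rabs (fst (trace d Y (opmul d Y rho' P)) -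
          fst (trace d Y (opmul d Y (opmul d Y eta (opmul d Y rho (adj eta))) P)))
      <= c1 * exp (- c2 * (l / 2))).
  { intros P hP. eapply Rle_trans; [|exact hbp].
    eapply Rle_trans; [|apply (trace_mul_le_tnorm d Y nY _ P herm hP)].
    right. f_equal.
    rewrite (trace_ext d Y (opmul d Y (opsub _ _) P)
      (opsub (opmul d Y rho' P) (opmul d Y (opmul d Y eta (opmul d Y rho (adj eta))) P)))
      by (intros; apply opmul_opsub_l).
    rewrite trace_opsub. reflexivity. }
  assert (subF := sub F hF). rewrite (trace_conjugation d Y rho eta F G nY hcomm hG) in subF.
  assert (subI := sub (idop Y) (idop_involution d Y nY)).
  rewrite (trace_conjugation d Y rho eta (idop Y) G nY) in subI; [|intros s t hs ht|assumption].
  2:{ transitivity (adj eta s t).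
      - apply (csum_idop_r d Y t (fun u => adj eta s u)); assumption.
      - symmetry. apply (csum_idop_l d Y s (fun u => adj eta u t)); assumption. }
  rewrite trace_idop_r in subI by assumption.
  rewrite (trace_ext d Y (opmul d Y rho (opmul d Y (idop Y) G)) (opmul d Y rho G)) in subI.
  2:{ intros s hs. apply opmul_ext; [reflexivity|]. intros u hu.
      apply (csum_idop_l d Y u (fun v => G v s)); assumption. }
  unfold rho' in subI at 1. rewrite gibbs_trace in subI by auto using removed_hermitian.
  (* [rho'] has no interaction at [y], so it factors with the Hamiltonian [zero_op] on that site,
     which is traced out. *)
  assert (eE : trace d Y (opmul d Y rho' F) =
    trace d (remove1 Y y) (opmul d (remove1 Y y)
      (gibbs d beta (remove1 Y y) (HY H (remove1 Y y))) (embed A (remove1 Y y) f))).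
  { assert (sp := split_remove1 Y y nY hy).
    apply (gibbs_marginal d beta hd Y (remove1 Y y) [y] _ _ zero_op); auto.
    - apply HY_hermitian; [assumption|apply sp].
    - intros s t _ _. symmetry. apply Cconj_C0.
    - intros s t hs ht. rewrite (HYon_embed d H Y (remove1 Y y) [y]) by assumption.
      unfold embed at 3. unfold zero_op. destruct (conf_eqb _ s t); ring.
    - intros x hx. apply In_minus. split; [apply hA, hx|]. intros [<-|[]].
      specialize (far y hx). rewrite sdist_refl in far. lra. }
  unfold local_expectation. rewrite <- eE. fold rho F.
  (* Since tr(rho F) is real, the real part of the product of the two expectations is the product of
     their real parts. *)
  simpl in hre. rewrite im_a in hre. simpl in subI.
  set (a := fst (trace d Y (opmul d Y rho F))) in *.
  set (q := fst (trace d Y (opmul d Y rho G))) in *.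
  set (r := fst (trace d Y (opmul d Y rho (opmul d Y F G)))) in *.
  set (p := fst (trace d Y (opmul d Y rho' F))) in *.
  assert (h1 : Rabs (r - a * q) <= ceta * eps (l / 2)).
  { eapply Rle_trans; [|eapply Rle_trans; [exact hcov|exact bound]].
    eapply Rle_trans; [|exact hre]. right. f_equal. ring. }
  assert (h2 : Rabs (a * q - a) <= c1 * exp (- c2 * (l / 2))).
  { replace (a * q - a) with (a * - (1 - q)) by ring. rewrite Rabs_mult, Rabs_Ropp.
    pose proof (Rabs_pos (1 - q)). nra. }
  replace (p - a) with ((p - r) + ((r - a * q) + (a * q - a))) by ring.
  eapply Rle_trans; [apply Rabs_triang|].
  pose proof (Rabs_triang (r - a * q) (a * q - a)). lra.
Qed.

(** A telescoping sum. [Y] varies in the induction, since every step applies clustering and belief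
    propagation to a smaller region. *)
Lemma remove_sites l A f bs : NoDup A -> involution d A f -> 0 < l ->
  forall Y, region Lam Y -> NoDup bs -> incl bs Y -> incl A Y ->
  (forall a b, In a A -> In b bs -> l <= sdist a b) -> (forall x, In x A -> ~ In x bs) ->
  Rabs (local_expectation d H beta A f Y - local_expectation d H beta A f (minus Y bs))
    <= INR (length bs) * (ceta * eps (l / 2) + 2 * (c1 * exp (- c2 * (l / 2)))).
Proof.
  intros nA hf hl. induction bs as [|b bs IH]; intros Y hY nbs ibs hA far dis.
  - replace (minus Y []) with Y.
    + rewrite Rminus_diag, Rabs_R0. simpl. lra.
    + unfold minus. symmetry. apply forallb_filter_id, forallb_forall. reflexivity.
  - inversion nbs as [|? ? nb nbs']; subst.
    assert (e : minus Y (b :: bs) = minus (remove1 Y b) bs).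
    { assert (hm : forall y, mem y (b :: bs) = orb (mem y [b]) (mem y bs)).
      { intros y. apply Bool.eq_iff_eq_true. rewrite Bool.orb_true_iff, !mem_In.
        simpl. tauto. }
      unfold remove1, minus. clear - hm. induction Y as [|y Y IHY]; [reflexivity|].
      cbn [filter]. rewrite hm. destruct (mem y [b]); cbn [orb negb filter]; [exact IHY|].
      destruct (mem y bs); cbn [negb]; rewrite IHY; reflexivity. }
    rewrite e.
    assert (hY1 : region Lam (remove1 Y b)).
    { destruct hY as [h1 h2]. split; [apply NoDup_filter; assumption|].
      intros x hx. apply In_minus in hx. apply h2, hx. }
    assert (step := remove_site Y b A f l hY (ibs b (or_introl eq_refl)) nA hA hf hl
      (fun a ha => far a b ha (or_introl eq_refl))).
    assert (rest := IH (remove1 Y b) hY1 nbs').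
    assert (rest' : Rabs (local_expectation d H beta A f (remove1 Y b) -
       local_expectation d H beta A f (minus (remove1 Y b) bs))
       <= INR (length bs) * (ceta * eps (l / 2) + 2 * (c1 * exp (- c2 * (l / 2))))).
    { apply rest.
      - intros x hx. apply In_minus. split; [apply ibs; right; assumption|].
        intros [<-|[]]; contradiction.
      - intros x hx. apply In_minus. split; [apply hA, hx|].
        intros [<-|[]]. apply (dis b hx). left; reflexivity.
      - intros a b' ha hb'. apply far; [assumption|right; assumption].
      - intros x hx hx'. apply (dis x hx). right; assumption. }
    clear rest. cbn [length]. rewrite S_INR. rewrite Rabs_minus_sym in step.
    match goal with |- Rabs (?p - ?q) <= _ =>
      replace (p - q) with ((p - local_expectation d H beta A f (remove1 Y b)) +
        (local_expectation d H beta A f (remove1 Y b) - q)) by ring end.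
    eapply Rle_trans; [apply Rabs_triang|]. lra.
Qed.

End Removal.

(** * Geometry of the shielding region *)

Lemma last_cons_default {T} (y : T) q x : last (y :: q) x = last q y.
Proof.
  revert x y. induction q as [|w q IH]; intros x y; [reflexivity|].
  change (last (w :: q) x = last (w :: q) y). rewrite !IH. reflexivity.
Qed.

(** A discrete intermediate value argument: the edge found is the one entering the first vertex in
    [Q]. *)
Lemma path_crossing (P Q : Site -> Prop) q x :
  is_path (x :: q) -> P x -> Q (last q x) -> (forall z, In z q -> P z \/ Q z) ->
  (forall z, P z -> ~ Q z) ->
  exists u v, In u (x :: q) /\ In v (x :: q) /\ P u /\ Q v /\ adjacent u v.
Proof.
  revert x. induction q as [|y q IH]; intros x hp hx hl hq dis.
  - exfalso. exact (dis x hx hl).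
  - destruct hp as [adj hp]. destruct (hq y (or_introl eq_refl)) as [py|qy].
    + destruct (IH y hp py) as (u & v & hu & hv & h).
      * rewrite <- (last_cons_default y q x). assumption.
      * intros z hz. apply hq; right; assumption.
      * assumption.
      * exists u, v. split; [right; assumption|split; [right; assumption|assumption]].
    + exists x, y. split; [left; reflexivity|split; [right; left; reflexivity|auto]].
Qed.

Lemma In_boundary c C B : In c (boundary C B) <-> In c C /\ exists b, In b B /\ sdist c b = 1.
Proof.
  unfold boundary. rewrite filter_In, existsb_exists.
  split; intros [h (b & hb & e)]; split; auto; exists b; split; auto;
    destruct (Req_EM_T (sdist c b) 1); congruence.
Qed.

(** A connected support meeting both [A] or [B] and [C] contains an edge between the two sides. If
    it starts in [A], it is by itself a path that avoids [B]; if it starts in [B], its other end is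
    a boundary site, which has been removed. *)
Lemma connected_avoids_boundary X A B C Z :
  (forall x, In x X <-> In x A \/ In x B \/ In x C) ->
  (forall x, In x A -> ~ In x B) -> (forall x, In x A -> ~ In x C) ->
  (forall x, In x B -> ~ In x C) -> separates X A B C ->
  connected Z -> incl Z (minus X (boundary C B)) ->
  incl Z (A ++ B) \/ incl Z (minus C (boundary C B)).
Proof.
  intros hX AB AC BC sep conn hZ.
  destruct (classic (exists u, In u Z /\ (In u A \/ In u B))) as [(x & hx & hxAB)|none].
  - destruct (classic (exists v, In v Z /\ In v C)) as [(y & hy & hyC)|none].
    + exfalso. destruct (conn x y hx hy) as (q & hp & hl & hq).
      destruct (path_crossing (fun z => In z A \/ In z B) (fun z => In z C) q x hp hxAB)
        as (u & v & hu & hv & hu' & hv' & adj).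
      * rewrite hl. assumption.
      * intros z hz. assert (h := hZ z (hq z (or_intror hz))).
        apply In_minus in h as [h _]. apply hX in h. tauto.
      * intros z [h|h]; [apply AC|apply BC]; assumption.
      * assert (zu := hZ u (hq u hu)). assert (zv := hZ v (hq v hv)).
        apply In_minus in zu as [zu _], zv as [zv nv].
        destruct hu' as [uA|uB].
        -- destruct (sep u [v] uA hv') as (b & hb & [<-|[<-|[]]]).
           ++ intros z [<-|[<-|[]]]; assumption.
           ++ split; [exact adj|exact I].
           ++ exact (AB _ uA hb).
           ++ exact (BC _ hb hv').
        -- apply nv, In_boundary. split; [assumption|]. exists u.
           split; [assumption|]. rewrite sdist_sym. exact adj.
    + left. intros z hz. assert (h := hZ z hz). apply In_minus in h as [h _].
      apply hX in h. apply in_app_iff.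
      assert (~ In z C) by (intros hc; apply none; eauto). tauto.
  - right. intros z hz. assert (h := hZ z hz). apply In_minus in h as [h hb].
    apply hX in h. apply In_minus. split; [|assumption].
    destruct h as [h|[h|h]]; [exfalso; apply none; eauto|exfalso; apply none; eauto|assumption].
Qed.

Theorem theorem1 :
  forall (D dmax k : nat) (J beta c1 c2 ceta : R),
  0 < beta ->
  exists K : R,
  forall (Lam : list Site) (d : Site -> nat) (H : Ham) (eps : R -> R),
    NoDup Lam ->
    (forall x, In x Lam -> length x = D) ->
    (forall x, (1 <= d x <= dmax)%nat) ->
    local_bounded Lam d H k J ->
    uniformly_clustering Lam d H beta eps ->
    belief_propagation Lam d H beta c1 c2 ceta ->
    forall (X A B C : list Site) (l : R),
      region Lam X -> NoDup A -> NoDup B -> NoDup C ->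
      (forall x, In x X <-> In x A \/ In x B \/ In x C) ->
      (forall x, In x A -> ~ In x B) -> (forall x, In x A -> ~ In x C) ->
      (forall x, In x B -> ~ In x C) ->
      0 < l ->
      (forall a c, In a A -> In c C -> l <= sdist a c) ->
      separates X A B C ->
      tnorm d A (opsub (ptrace d (B ++ C) (gibbs d beta X (HY H X)))
                       (ptrace d B (gibbs d beta (A ++ B) (HY H (A ++ B)))))
        <= K * INR (length (boundary C B)) * (eps (l / 2) + c1 * exp (- c2 * (l / 2))).
Proof.
  (* One removal costs ceta eps + 2 gamma, at most this constant times eps + gamma when both are
     nonnegative. The absolute value is there because [ceta] comes without a sign. *)
  intros D dmax k J beta c1 c2 ceta _. exists (2 + Rabs ceta).
  intros Lam d H eps _ dim hdim [_ loc] clust bp X A B C l hX nA nB nC part AB AC BC hl far sep.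
  assert (hd : forall x, (1 <= d x)%nat) by (intros x; apply hdim).
  assert (hH : hermitian_terms d H).
  { intros Z h hp. destruct (loc Z h hp) as (nZ & _ & _ & _ & _ & hZ & _). auto. }
  assert (nX : NoDup X) by apply hX.
  assert (nAB : NoDup (A ++ B)) by (apply NoDup_app; assumption).
  assert (nBC : NoDup (B ++ C)) by (apply NoDup_app; assumption).
  assert (spX : split_region X A (B ++ C)).
  { split; [assumption|split; [assumption|split; [assumption|split]]]; intros x;
      rewrite in_app_iff; [apply part|]. intros ha [hb|hc]; [eapply AB|eapply AC]; eauto. }
  assert (spAB : split_region (A ++ B) A B).
  { split; [assumption|split; [assumption|split; [assumption|split]]]; intros x; auto.
    apply in_app_iff. }
  set (bd := boundary C B).
  assert (nbd : NoDup bd) by (apply NoDup_filter; assumption).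
  assert (bdC : incl bd C) by (intros x hx; apply In_boundary in hx; apply hx).
  assert (spR : split_region (minus X bd) (A ++ B) (minus C bd)).
  { split; [apply NoDup_filter; assumption|split; [assumption|split;
      [apply NoDup_filter; assumption|split]]]; intros x; rewrite ?In_minus, ?in_app_iff, ?part.
    - specialize (bdC x). specialize (AC x). specialize (BC x). tauto.
    - specialize (AC x). specialize (BC x). tauto. }
  set (Del := opsub _ _).
  assert (hDel : hermitian d A Del).
  { apply hermitian_opsub.
    - apply (ptrace_hermitian d X A (B ++ C) spX), gibbs_hermitian; auto using HY_hermitian.
    - apply (ptrace_hermitian d (A ++ B) A B spAB), gibbs_hermitian; auto using HY_hermitian. }
  destruct (tnorm_dual d A nA Del hDel) as (f & hf & ->).
  assert (eDel : fst (trace d A (opmul d A Del f)) =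
    local_expectation d H beta A f X - local_expectation d H beta A f (A ++ B)).
  { unfold local_expectation. rewrite <- (trace_ptrace d X A (B ++ C) spX).
    rewrite <- (trace_ptrace d (A ++ B) A B spAB). unfold Del.
    rewrite (trace_ext d A (opmul d A (opsub _ _) f) (opsub _ _))
      by (intros; apply opmul_opsub_l).
    rewrite trace_opsub. reflexivity. }
  assert (eR : local_expectation d H beta A f (A ++ B) =
    local_expectation d H beta A f (minus X bd)).
  { unfold local_expectation. f_equal. symmetry.
    apply (gibbs_marginal d beta hd (minus X bd) (A ++ B) (minus C bd) _ _ (HY H (minus C bd)));
      auto.
    - apply HY_hermitian; assumption.
    - apply HY_hermitian; [assumption|apply spR].
    - intros a b _ _. apply (HY_decouple d); [assumption|assumption|].
      intros Z h hp. destruct (loc Z h hp) as (_ & ne & _ & _ & conn & _).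
      split; [assumption|]. intros hZ.
      apply (connected_avoids_boundary X A B C Z); assumption.
    - apply incl_appl, incl_refl. }
  rewrite eDel, eR.
  eapply Rle_trans; [apply Rle_abs|].
  eapply Rle_trans.
  { apply (remove_sites D Lam d H beta c1 c2 ceta eps dim hd hH clust bp l A f bd); auto.
    - intros x hx. apply part. auto.
    - intros x hx. apply part. auto.
    - intros x hx hx'. apply (AC x hx), bdC, hx'. }
  (* With an empty boundary both sides vanish; otherwise one of its sites serves as witness for
     [gamma_nonneg]. *)
  destruct bd as [|y bd'] eqn:ebd; [simpl; lra|]. rewrite <- ebd in *.
  assert (hy : In y X) by (apply part; right; right; apply bdC; rewrite ebd; left; reflexivity).
  pose proof (gamma_nonneg Lam d H beta c1 c2 ceta hH bp X y (l / 2) hX hy ltac:(lra)) as hgam.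
  assert (heps : 0 <= eps (l / 2)) by (eapply clustering_nonneg; eauto; lra).
  pose proof (pos_INR (length bd)). pose proof (Rle_abs ceta). pose proof (Rabs_pos ceta).
  rewrite (Rmult_comm (2 + Rabs ceta)), Rmult_assoc. apply Rmult_le_compat_l; [assumption|].
  revert hgam. generalize (c1 * exp (- c2 * (l / 2))). intros gam hgam. nra.
Qed.
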